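(* For the boundary value problem (P) (defined in the context), the maximum geometric multiplicity of an eigenvalue is $2$, and eigenvalues of geometric multiplicity $2$ can only occur at poles of $\mu$ or $\nu$. A number $\lambda$ is an eigenvalue of (P) of geometric multiplicity $2$ if and only if one of the following holds: I. $\lambda$ is a pole of $\mu$ (and not of $\nu$), and $\lambda$ is an eigenvalue of $\ell y=\lambda y$ on $(-a,0)$ with boundary conditions $y(-a)\cos\alpha=y'(-a)\sin\alpha$ and $\nu(\lambda)y'(0^-)+y(0^-)=0$, and an eigenvalue of $\ell y=\lambda y$ on $(0,b)$ with boundary conditions $y(0^+)=0$ and $y(b)\cos\beta=y'(b)\sin\beta$; or II. $\lambda$ is a pole of $\nu$ (and not of $\mu$), and $\lambda$ is an eigenvalue of $\ell y=\lambda y$ on $(-a,0)$ with boundary conditions $y(-a)\cos\alpha=y'(-a)\sin\alpha$ and $y'(0^-)=0$, and an eigenvalue of $\ell y=\lambda y$ on $(0,b)$ with boundary conditions $y(0^+)\mu(\lambda)=y'(0^+)$ and $y(b)\cos\beta=y'(b)\sin\beta$; or III. $\lambda$ is a pole of both $\mu$ and $\nu$, and $\lambda$ is an eigenvalue of $\ell y=\lambda y$ on $(-a,0)$ with boundary conditions $y(-a)\cos\alpha=y'(-a)\sin\alpha$ and $y'(0^-)=0$, and an eigenvalue of $\ell y=\lambda y$ on $(0,b)$ with boundary conditions $y(0^+)=0$ and $y(b)\cos\beta=y'(b)\sin\beta$.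
   Context: Let $a,b>0$, $q\in L^2(-a,b)$, $\alpha\in[0,\pi)$, $\beta\in(0,\pi]$, and $\ell y:=-y''+qy$. Let $N,M\in\mathbb{N}_0$ (empty sums are $0$), $\eta,\kappa\ge 0$, $\xi,\zeta\in\mathbb{R}$, real numbers $c_1<\dots<c_N$ and $d_1<\dots<d_M$, and $b_i>0$ ($i=1,\dots,N$), $a_j>0$ ($j=1,\dots,M$). Put $$\mu(\lambda)=-\Big(\lambda\eta-\xi-\sum_{i=1}^N\frac{b_i^2}{\lambda-c_i}\Big),\qquad \nu(\lambda)=\lambda\kappa+\zeta-\sum_{j=1}^M\frac{a_j^2}{\lambda-d_j}.$$ For a function $y$ on $(-a,0)\cup(0,b)$ write $y(0^\pm),y'(0^\pm)$ for one-sided limits at $0$, $\Delta y=y(0^+)-y(0^-)$, $\Delta' y=y'(0^+)-y'(0^-)$. Problem (P) with spectral parameter $\lambda\in\mathbb{C}$: $\ell y=\lambda y$ on $(-a,0)$ and on $(0,b)$, with $y,y',\ell y$ restricted to $(-a,0)$ in $L^2(-a,0)$ and restricted to $(0,b)$ in $L^2(0,b)$; boundary conditions $y(-a)\cos\alpha=y'(-a)\sin\alpha$ and $y(b)\cos\beta=y'(b)\sin\beta$; transmission conditions $y(0^+)\mu(\lambda)=\Delta' y$ and $y'(0^-)\nu(\lambda)=\Delta y$. If $\lambda$ is a pole of $\mu$, the first transmission condition is read as $y(0^+)=0$ (so that, if $\lambda$ is not a pole of $\nu$, the second becomes $y'(0^-)\nu(\lambda)=-y(0^-)$); if $\lambda$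 is a pole of $\nu$, the second is read as $y'(0^-)=0$ (so that, if $\lambda$ is not a pole of $\mu$, the first becomes $y(0^+)\mu(\lambda)=y'(0^+)$). $\lambda$ is an eigenvalue if (P) has a non-zero solution $y$ (eigenfunction), and its geometric multiplicity is the dimension of the solution space. *)

(* Defs.v *)
From mathcomp Require Import all_boot all_order all_algebra.
From mathcomp Require Import all_classical all_reals all_analysis.
From mathcomp Require Import complex.

Set Implicit Arguments.
Unset Strict Implicit.
Unset Printing Implicit Defensive.

Import Order.TTheory GRing.Theory Num.Theory.
Import numFieldNormedType.Exports.

Local Open Scope classical_set_scope.
Local Open Scope complex_scope.
Local Open Scope ring_scope.

(* Calculus for functions R -> R[i]: R[i] has no normed R-module structure in
   the libraries, so limits and derivatives are taken componentwise. *)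

Definition lim_exists (R : realType) (F : set_system R) (f : R -> R[i]) : Prop :=
  cvg (complex.Re (f x) @[x --> F]) /\ cvg (complex.Im (f x) @[x --> F]).

Definition climit (R : realType) (F : set_system R) (f : R -> R[i]) : R[i] :=
  lim (complex.Re (f x) @[x --> F]) +i* lim (complex.Im (f x) @[x --> F]).

Definition cderivable (R : realType) (f : R -> R[i]) (x : R) : Prop :=
  derivable (fun t => complex.Re (f t)) x 1 /\
  derivable (fun t => complex.Im (f t)) x 1.

Definition cderiv (R : realType) (f : R -> R[i]) (x : R) : R[i] :=
  derive1 (fun t => complex.Re (f t)) x +i* derive1 (fun t => complex.Im (f t)) x.

(* The library's Lebesgue measure lives on the Borel sets, and an element of
   L^2(A) is a class modulo a.e. equality: f belongs to L^2(A) when it agrees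
   a.e. on A with a Borel function whose squared modulus is integrable. *)
Definition in_L2 (R : realType) (A : set R) (f : R -> R[i]) : Prop :=
  exists g : R -> R[i],
    [/\ measurable_fun A (fun x => complex.Re (g x)),
        measurable_fun A (fun x => complex.Im (g x)),
        (\int[@lebesgue_measure R]_(x in A)
            (complex.Re (g x) ^+ 2 + complex.Im (g x) ^+ 2)%:E < +oo)%E &
        {ae @lebesgue_measure R, forall x, A x -> f x = g x}].

(* The subintervals [u i, v i] are listed from left to right, hence
   non-overlapping. *)
Definition abs_continuous (R : realType) (s t : R) (f : R -> R[i]) : Prop :=
  forall e : R, 0 < e -> exists2 d : R, 0 < d &
    forall (n : nat) (u v : nat -> R),
      (forall i, (i < n)%N -> [/\ s <= u i, u i <= v i & v i <= t]) ->
      (forall i, (i.+1 < n)%N -> v i <= u i.+1) ->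
      \sum_(i < n) (v i - u i) < d ->
      \sum_(i < n) ComplexField.Normc.normc (f (v i) - f (u i)) < e.

(* y'' is the classical derivative of y', which exists a.e. when y' is locally
   absolutely continuous. *)
Definition sl_ell (R : realType) (q y : R -> R[i]) (x : R) : R[i] :=
  - cderiv (cderiv y) x + q x * y x.

(* The functions y on (s,t) to which sl_ell applies, with y, y', sl_ell q y in
   L^2(s,t) and with the one-sided limits at s and t that enter the boundary and
   transmission conditions. *)
Definition sl_regular (R : realType) (q : R -> R[i]) (s t : R)
    (y : R -> R[i]) : Prop :=
  [/\ forall x, s < x < t -> cderivable y x,
      forall s' t', s < s' -> s' < t' -> t' < t ->
        abs_continuous s' t' (cderiv y),
      [/\ in_L2 `]s, t[ y, in_L2 `]s, t[ (cderiv y) &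
          in_L2 `]s, t[ (sl_ell q y)],
      lim_exists s^'+ y /\ lim_exists s^'+ (cderiv y) &
      lim_exists t^'- y /\ lim_exists t^'- (cderiv y)].

Definition sl_solution (R : realType) (q : R -> R[i]) (lam : R[i]) (s t : R)
    (y : R -> R[i]) : Prop :=
  sl_regular q s t y /\
  {ae @lebesgue_measure R, forall x, s < x < t ->
     cderivable (cderiv y) x /\ sl_ell q y x = lam * y x}.

(* Data of the problem: sl_c, sl_bres stand for the c_i, b_i of mu and
   sl_d, sl_ares for the d_j, a_j of nu. *)
Record sl_problem (R : realType) := SLProblem {
  sl_a : R;
  sl_b : R;
  sl_q : R -> R[i];
  sl_alpha : R;
  sl_beta : R;
  sl_N : nat;
  sl_M : nat;
  sl_eta : R;
  sl_kappa : R;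
  sl_xi : R;
  sl_zeta : R;
  sl_c : 'I_sl_N -> R;
  sl_bres : 'I_sl_N -> R;
  sl_d : 'I_sl_M -> R;
  sl_ares : 'I_sl_M -> R;
  sl_a_gt0 : 0 < sl_a;
  sl_b_gt0 : 0 < sl_b;
  sl_q_L2 : in_L2 `]- sl_a, sl_b[ sl_q;
  sl_alpha_range : 0 <= sl_alpha < pi;
  sl_beta_range : 0 < sl_beta <= pi;
  sl_eta_ge0 : 0 <= sl_eta;
  sl_kappa_ge0 : 0 <= sl_kappa;
  sl_c_incr : forall i j : 'I_sl_N, (i < j)%N -> sl_c i < sl_c j;
  sl_d_incr : forall i j : 'I_sl_M, (i < j)%N -> sl_d i < sl_d j;
  sl_bres_gt0 : forall i, 0 < sl_bres i;
  sl_ares_gt0 : forall j, 0 < sl_ares j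
}.

Arguments sl_c {R} s i.
Arguments sl_bres {R} s i.
Arguments sl_d {R} s j.
Arguments sl_ares {R} s j.

Definition sl_mu (R : realType) (P : sl_problem R) (lam : R[i]) : R[i] :=
  - (lam * (sl_eta P)%:C - (sl_xi P)%:C
     - \sum_(i < sl_N P) (sl_bres P i ^+ 2)%:C / (lam - (sl_c P i)%:C)).

Definition sl_nu (R : realType) (P : sl_problem R) (lam : R[i]) : R[i] :=
  lam * (sl_kappa P)%:C + (sl_zeta P)%:C
  - \sum_(j < sl_M P) (sl_ares P j ^+ 2)%:C / (lam - (sl_d P j)%:C).

(* Pole of a function whose singularities are isolated, as is the case for the
   rational functions sl_mu and sl_nu.  The filter is punctured: the value of
   the total function f at lam, where x / 0 = 0, plays no role. *)
Definition is_pole (K : numFieldType) (f : K -> K) (lam : K) : Prop :=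
  `|f z| @[z --> lam^'] --> +oo.

Definition bc_left (R : realType) (P : sl_problem R) (y : R -> R[i]) : Prop :=
  climit (- sl_a P)^'+ y * (cos (sl_alpha P))%:C
  = climit (- sl_a P)^'+ (cderiv y) * (sin (sl_alpha P))%:C.

Definition bc_right (R : realType) (P : sl_problem R) (y : R -> R[i]) : Prop :=
  climit (sl_b P)^'- y * (cos (sl_beta P))%:C
  = climit (sl_b P)^'- (cderiv y) * (sin (sl_beta P))%:C.

Definition sl_jump (R : realType) (f : R -> R[i]) : R[i] :=
  climit 0^'+ f - climit 0^'- f.

Definition transmission_mu (R : realType) (P : sl_problem R) (lam : R[i])
    (y : R -> R[i]) : Prop :=
  (is_pole (sl_mu P) lam -> climit 0^'+ y = 0) /\
  (~ is_pole (sl_mu P) lam ->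
     climit 0^'+ y * sl_mu P lam = sl_jump (cderiv y)).

Definition transmission_nu (R : realType) (P : sl_problem R) (lam : R[i])
    (y : R -> R[i]) : Prop :=
  (is_pole (sl_nu P) lam -> climit 0^'- (cderiv y) = 0) /\
  (~ is_pole (sl_nu P) lam ->
     climit 0^'- (cderiv y) * sl_nu P lam = sl_jump y).

Definition problem_solution (R : realType) (P : sl_problem R) (lam : R[i])
    (y : R -> R[i]) : Prop :=
  [/\ sl_solution (sl_q P) lam (- sl_a P) 0 y /\
      sl_solution (sl_q P) lam 0 (sl_b P) y,
      bc_left P y, bc_right P y,
      transmission_mu P lam y & transmission_nu P lam y].

Definition problem_dom (R : realType) (P : sl_problem R) : set R :=
  `]- sl_a P, 0[ `|` `]0, sl_b P[.

Definition nonzero_on (R : realType) (D : set R) (y : R -> R[i]) : Prop :=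
  exists2 x, D x & y x != 0.

Definition sl_eigenvalue (R : realType) (P : sl_problem R) (lam : R[i]) : Prop :=
  exists2 y, problem_solution P lam y & nonzero_on (problem_dom P) y.

(* The linear space S of functions on D has complex dimension n; elements of S
   are represented by total functions, of which only the values on D matter. *)
Definition has_dim (R : realType) (D : set R) (S : set (R -> R[i]))
    (n : nat) : Prop :=
  exists e : 'I_n -> R -> R[i],
    [/\ forall i, S (e i),
        forall k : 'I_n -> R[i],
          (forall x, D x -> \sum_(i < n) k i * e i x = 0) ->
          forall i, k i = 0 &
        forall y, S y -> exists k : 'I_n -> R[i],
          forall x, D x -> y x = \sum_(i < n) k i * e i x].

Definition sl_geometric_multiplicity (R : realType) (P : sl_problem R)
    (lam : R[i]) (n : nat) : Prop :=
  has_dim (problem_dom P) (problem_solution P lam) n.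

Definition sl_eigenvalue_of_mult (R : realType) (P : sl_problem R)
    (lam : R[i]) (n : nat) : Prop :=
  sl_eigenvalue P lam /\ sl_geometric_multiplicity P lam n.

(* bc0 is the boundary condition at 0, applied to the limits of y and y'. *)
Definition left_eigenvalue (R : realType) (P : sl_problem R) (lam : R[i])
    (bc0 : R[i] -> R[i] -> Prop) : Prop :=
  exists2 y, [/\ sl_solution (sl_q P) lam (- sl_a P) 0 y, bc_left P y &
                 bc0 (climit 0^'- y) (climit 0^'- (cderiv y))] &
             nonzero_on `]- sl_a P, 0[ y.

Definition right_eigenvalue (R : realType) (P : sl_problem R) (lam : R[i])
    (bc0 : R[i] -> R[i] -> Prop) : Prop :=
  exists2 y, [/\ sl_solution (sl_q P) lam 0 (sl_b P) y, bc_right P y &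
                 bc0 (climit 0^'+ y) (climit 0^'+ (cderiv y))] &
             nonzero_on `]0, sl_b P[ y.

(* Main.v *)
Require Import Defs.
From mathcomp Require Import all_boot all_order all_algebra.
From mathcomp Require Import all_classical all_reals all_analysis.
From mathcomp Require Import measurable_realfun complex ring lra.

Import Order.TTheory GRing.Theory Num.Theory.
Import numFieldNormedType.Exports.
Local Open Scope classical_set_scope.
Local Open Scope ring_scope.
Set Implicit Arguments.
Unset Strict Implicit.
Unset Printing Implicit Defensive.

(** The interface at 0 cuts the problem into two initial value problems.  On
(-a,0) the boundary condition at -a leaves the Cauchy data (y(-a), y'(-a)) on a
complex line, and a solution is determined by its Cauchy data at either end of
the interval; the same holds on (0,b).  The pair [left_datum], [right_datum] of
coordinates on these two lines is therefore a faithful linear map from the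
solutions to C^2, and the multiplicity is at most 2 ([sides_faithful],
[faithful_has_dim]).

If neither mu nor nu has a pole at lambda, the transmission conditions compute
(y(0+), y'(0+)) from (y(0-), y'(0-)), so that the left datum alone is faithful
and the multiplicity is at most 1 ([no_pole_simple]).  If there is a pole, the
transmission conditions decouple into one homogeneous condition on the left
limits and one on the right limits.  The solution space is then the direct sum
of the solution spaces of two one-sided problems, each of dimension at most 1,
and the dimension is 2 exactly when lambda is an eigenvalue of both
([double_eigenvalueP]).  The bound 2 is attained by q = 0, mu = 0 and
nu = -1/lambda with Neumann conditions at both ends: at lambda = 0 the
functions that are constant on each side are solutions.

The analytic core is the uniqueness for the initial value problem when q is
only in L^2, so that y'' = (q - lambda) y holds almost everywhere.  The energy
E = |y|^2 + |y'|^2 is absolutely continuous on compact subintervals and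
satisfies |E'| <= h E almost everywhere with h = 2 + 2|lambda|^2 + 2|q|^2,
which is integrable.  If H is a primitive of h, then E exp(-H) has a derivative
<= 0 and E exp(H) a derivative >= 0 almost everywhere; an absolutely continuous
function with this property is monotone ([ac_nonincreasing]).  As H is bounded,
the values of E at any two points are comparable up to one constant
([energy_comparison]), and E vanishes identically as soon as it tends to 0 at
an end. *)

(** * Absolutely continuous functions are governed by their derivatives *)

(** These are the families of intervals over which [abs_continuous] quantifies;
they are named because the proof of [ac_nonincreasing] builds one. *)
Definition chain (R : realType) (c d : R) (n : nat) (u v : nat -> R) : Prop :=
  (forall i, (i < n)%N -> [/\ c <= u i, u i <= v i & v i <= d]) /\
  (forall i, (i.+1 < n)%N -> v i <= u i.+1).

Definition ac (R : realType) (c d : R) (f : R -> R) : Prop :=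
  forall e : R, 0 < e -> exists2 r : R, 0 < r &
    forall n u v, chain c d n u v ->
      \sum_(i < n) (v i - u i) < r -> \sum_(i < n) `|f (v i) - f (u i)| < e.

Lemma chain_le (R : realType) (c d : R) n u v : chain c d n u v ->
  forall i j, (i < j < n)%N -> v i <= u j.
Proof.
move=> [uv vu] i j /andP[]; elim: j => // j IH; rewrite ltnS leq_eqVlt.
case/predU1P=> [-> | ij] jn; first exact: vu.
apply: le_trans (IH ij (ltnW jn)) _; apply: le_trans (vu _ jn).
by case: (uv _ (ltnW jn)).
Qed.

Lemma chain_trivIset (R : realType) (c d : R) n u v : chain c d n u v ->
  trivIset [set i | (i < n)%N] (fun i => `]u i, v i]%classic).
Proof.
move=> ch i j /= iN jN [x []] /=; rewrite !in_itv/= => /andP[uix xvi] /andP[ujx xvj].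
case: (ltngtP i j) => // ij; exfalso.
  have := @chain_le _ _ _ _ _ _ ch i j; rewrite ij jN => /(_ isT); lra.
have := @chain_le _ _ _ _ _ _ ch j i; rewrite ij iN => /(_ isT); lra.
Qed.

Lemma chain_measure (R : realType) (c d : R) n u v : chain c d n u v ->
  lebesgue_measure (\big[setU/set0]_(i < n) `]u i, v i]%classic)
  = (\sum_(i < n) (v i - u i))%:E.
Proof.
move=> ch; pose F i := `]u i, v i]%classic.
have mF i : measurable (F i) by exact: measurable_itv.
rewrite (@measure_semi_additive_ord_I _ _ _ lebesgue_measure F n) //;
    last 2 first.
- exact: chain_trivIset ch.
- by apply: bigsetU_measurable => i _; exact: mF.
rewrite -sumEFin; apply: eq_bigr => i _.
apply: etrans; first exact: lebesgue_measure_itv.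
rewrite /= lte_fin.
case: ltP => // h; have [uv _] := ch; have [_ h' _] := uv _ (ltn_ord i).
  by have /eqP -> : v i == u i; [rewrite eq_le h h' | rewrite subrr].
by move=> i _; exact: mF.
Qed.

(** The points u and v lie on the two sides of z and none of them need be z
itself: this is the form in which the pointwise bound is summed along a
partition whose nodes are not the points of differentiability. *)
Lemma deriv_le0_increment (R : realType) (G : R -> R) (z e : R) : 0 < e ->
  derivable G z 1 -> derive1 G z <= 0 ->
  exists2 r : R, 0 < r & forall u v, z - r < u -> u <= z -> z <= v -> v < z + r ->
    G v - G u <= e * (v - u).
Proof.
move=> e0 dG G0.
have cvG : h^-1 *: (G (h + z) - G z) @[h --> 0^'] --> derive1 G z.
  rewrite derive1E /derive; have := dG; rewrite /derivable.
  by under eq_fun do rewrite /= /GRing.scale /= mulr1.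
have : \forall h \near 0^', h^-1 *: (G (h + z) - G z) < e.
  by apply: (@cvgr_lt _ _ _ _ _ _ cvG); lra.
rewrite near_withinE => /nbhs_ballP[r /= r0 H].
have step h : `|h| < r -> h != 0 -> (G (h + z) - G z) / h < e.
  move=> hr h0; have := H h; rewrite /ball/= sub0r normrN => /(_ hr h0).
  by rewrite mulrC.
exists r => // u v ur uz zv vr.
have hv : G v - G z <= e * (v - z).
  case: (eqVneq v z) => [->|vz]; first by rewrite !subrr mulr0.
  have vz0 : 0 < v - z by rewrite subr_gt0 lt_neqAle eq_sym vz.
  have := step (v - z); rewrite subrK gtr0_norm// ltrBlDl => /(_ vr).
  by rewrite gt_eqF// => /(_ isT); rewrite ltr_pdivrMr// => /ltW.
have hu : G z - G u <= e * (z - u).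
  case: (eqVneq u z) => [->|uz']; first by rewrite !subrr mulr0.
  have vz0 : u - z < 0 by rewrite subr_lt0 lt_neqAle uz'.
  have := step (u - z); rewrite subrK ltr0_norm// opprB => h.
  have := h ltac:(lra) ltac:(by rewrite lt_eqF).
  rewrite ltr_ndivrMr//; lra.
lra.
Qed.

(** Cover the exceptional null set by an open set O of small measure.  Around a
point outside O the increments of G are at most e times the length; around a
point of O the interval itself lies in O, and the absolute continuity of G makes
the total variation over such intervals less than e.  The set of the points that
can be reached from c by steps of these two kinds contains its supremum and
goes beyond it, so it reaches d. *)
Lemma ac_nonincreasing (R : realType) (c d : R) (G : R -> R) : c <= d ->
  ac c d G ->
  {ae lebesgue_measure, forall x, c < x < d -> derivable G x 1 /\ derive1 G x <= 0} ->
  G d <= G c.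
Proof.
move=> cd acG [N [mN N0 subN]].
suff key : forall e, 0 < e -> G d - G c <= e * (d - c) + e.
  rewrite -subr_le0; apply/ler_addgt0Pl => e e0.
  have D : 0 < d - c + 1 by lra.
  have := key (e / (d - c + 1)) (divr_gt0 e0 D); rewrite addr0.
  rewrite (_ : _ / _ * _ + _ = e) //; field; rewrite gt_eqF//.
move=> e e0; have [r r0 acr] := acG e e0.
have mN' : measurable (N `|` [set c; d]) by do 2?apply: measurableU.
have N'0 : lebesgue_measure (N `|` [set c; d]) = 0%E.
  rewrite measureU0 //; first exact: measurableU.
  by rewrite measureU0 // ; exact: lebesgue_measure_set1.
have [|O [opO NO muO]] := @lebesgue_regularity_outer R _ r mN' _ r0.
  exact: (eq_ind_r (fun t => (t < +oo)%E) (ltry 0) N'0).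
have mO : measurable O by exact: open_measurable.
have {}muO : (lebesgue_measure O < r%:E)%E.
  have -> : O = (O `\` (N `|` [set c; d])) `|` (N `|` [set c; d]).
    by rewrite setUC setDUK.
  by rewrite measureU0//; exact: measurableD.
pose step x := exists n u v, [/\ chain c x n u v,
  forall i, (i < n)%N -> `[u i, v i] `<=` O &
  G x - G c <= e * (x - c) + \sum_(i < n) `|G (v i) - G (u i)|].
have stepc : step c.
  exists 0%N, (fun=> c), (fun=> c); split=> //.
  by rewrite !subrr mulr0 big_ord0 addr0.
(* a step over which G is controlled pointwise: the family is unchanged *)
have step_good x y : step x -> x <= y -> G y - G x <= e * (y - x) -> step y.
  move=> [n [u [v [[uv vu] uvO H]]]] xy Gxy; exists n, u, v; split=> //; last lra.
  by split=> // i /uv[? ? ?]; split=> //; apply: le_trans xy.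
(* a step inside O: the interval [x, y] is appended to the family *)
have step_bad x y : step x -> c <= x -> x <= y -> `[x, y] `<=` O -> step y.
  move=> [n [u [v [[uv vu] uvO H]]]] cx xy xyO.
  exists n.+1, (fun i => if (i < n)%N then u i else x),
    (fun i => if (i < n)%N then v i else y); split.
  - split=> i; rewrite ltnS; first by case: ltnP => [/uv[? ? ?]|]; split=> //; lra.
    by move=> iltn; rewrite iltn; case: ltnP => [/vu//|_]; case: (uv i iltn).
  - by move=> i _; case: ltnP => [/uvO|].
  - rewrite big_ord_recr/= ltnn.
    under eq_bigr do rewrite ltn_ord.
    have := ler_norm (G y - G x); have : 0 <= e * (y - x) by rewrite mulr_ge0; lra.
    lra.
have local z : c <= z <= d -> exists2 s, 0 < s & forall x y, c <= x -> y <= d ->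
    z - s < x -> x <= z -> z <= y -> y < z + s -> step x -> step y.
  move=> /andP[cz zd].
  case: (pselect ((N `|` [set c; d]) z)) => [/NO Oz|].
    have /nbhs_ballP[s /= s0 sO] : nbhs z O by exact: open_nbhs_nbhs.
    exists s => // x y cx yd xs xz zy ys Sx; apply: (step_bad x) => //; first lra.
    move=> w /=; rewrite in_itv/= => /andP[xw wy]; apply: sO.
    rewrite /ball/= ltr_norml; lra.
  move=> /not_orP[Nz /not_orP[zc zd']].
  have zcd : c < z < d.
    by rewrite !lt_neqAle cz zd !andbT eq_sym; apply/andP; split; apply/eqP.
  have [dG G0] : derivable G z 1 /\ derive1 G z <= 0.
    by apply: contrapT => h; apply: Nz; apply: subN => /(_ zcd).
  have [s s0 sG] := deriv_le0_increment e0 dG G0.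
  exists s => // x y cx yd xs xz zy ys Sx; apply: (step_good x) => //; first lra.
  exact: sG.
pose A := [set x | c <= x <= d /\ step x].
have Ac : A c by split; [rewrite lexx | exact: stepc].
have ubA : ubound A d by move=> x [/andP[]].
have hsA : has_sup A by split; [exists c | exists d].
have cz : c <= sup A by apply: ub_le_sup => //; exists d.
have zd : sup A <= d by apply: ge_sup => //; exists c.
have [|s s0 loc] := local (sup A); first by rewrite cz zd.
have [x [/andP[cx xd] Sx] zx] := sup_adherent s0 hsA.
have xz : x <= sup A by apply: ub_le_sup => //; [exists d | split; [rewrite cx|]].
have Sd : step d.
  case: (ltP d (sup A + s)) => dz; first exact: (loc x).
  have Sy : step (sup A + s / 2) by apply: (loc x) => //; lra.
  have : sup A + s / 2 <= sup A.
    by apply: ub_le_sup; [exists d | split=> //; apply/andP; split; lra].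
  lra.
have [n [u [v [ch uvO H]]]] := Sd.
apply: (le_trans H); rewrite lerD2l; apply/ltW/acr => //.
rewrite -lte_fin -(chain_measure ch); apply: le_lt_trans muO.
apply: le_measure; rewrite ?inE//.
  by apply: bigsetU_measurable => i _; exact: measurable_itv.
rewrite -(bigcup_mkord n (fun i => `]u i, v i]%classic)) => x' [i /= iltn].
rewrite in_itv/= => /andP[ux xv].
by apply: (uvO i iltn); rewrite /= in_itv/= xv ltW.
Qed.

(** * Operations on absolutely continuous functions and Gronwall's inequality *)

Lemma chain1 (R : realType) (c d x y : R) : c <= x -> x <= y -> y <= d ->
  chain c d 1 (fun=> x) (fun=> y).
Proof. by move=> cx xy yd; split=> [[]|[]]. Qed.

(** All the closure properties below reduce to a bound of the increments of G by
those of two functions known to be absolutely continuous. *)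
Lemma ac_le (R : realType) (c d : R) (K : R) (f g G : R -> R) :
  ac c d f -> ac c d g -> 0 <= K ->
  (forall x y, c <= x -> x <= y -> y <= d ->
    `|G y - G x| <= K * (`|f y - f x| + `|g y - g x|)) ->
  ac c d G.
Proof.
move=> acf acg K0 H e e0.
have e1 : 0 < e / (2 * (K + 1)) by rewrite divr_gt0//; lra.
have [r r0 fr] := acf _ e1; have [s s0 gs] := acg _ e1.
exists (Num.min r s) => [|n u v ch]; first by rewrite lt_min r0.
rewrite lt_min => /andP[/(fr _ _ _ ch) fe /(gs _ _ _ ch) ge].
apply: (@le_lt_trans _ _ (K * (\sum_(i < n) `|f (v i) - f (u i)| +
  \sum_(i < n) `|g (v i) - g (u i)|))).
  rewrite -big_split/= mulr_sumr; apply: ler_sum => i _.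
  by have [ch1 _] := ch; have [? ? ?] := ch1 i (ltn_ord i); exact: H.
apply: (@le_lt_trans _ _ (K * (e / (2 * (K + 1)) + e / (2 * (K + 1))))).
  by rewrite ler_wpM2l// lerD// ltW.
rewrite (_ : K * _ = e * (K / (K + 1))); last by field; lra.
by rewrite gtr_pMr// ltr_pdivrMr; lra.
Qed.

Lemma ac_lipschitz (R : realType) (c d K : R) (f : R -> R) : 0 <= K ->
  (forall x y, c <= x -> x <= y -> y <= d -> `|f y - f x| <= K * (y - x)) ->
  ac c d f.
Proof.
move=> K0; have acid : ac c d id.
  move=> e e0; exists e => // n u v [uv _]; apply: le_lt_trans.
  apply: ler_sum => i _; have [? ? ?] := uv i (ltn_ord i).
  by rewrite ger0_norm// subr_ge0.
move=> H; apply: (ac_le acid acid K0) => x y cx xy yd.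
apply: le_trans (H _ _ cx xy yd) _; rewrite ler_wpM2l//.
by rewrite ger0_norm ?subr_ge0// lerDl subr_ge0.
Qed.

(** Increments over lengths less than some r are less than 1, and finitely many
steps of length r/2 reach every point. *)
Lemma ac_bounded (R : realType) (c d : R) (f : R -> R) : ac c d f ->
  exists2 M : R, 0 <= M & forall x, c <= x -> x <= d -> `|f x| <= M.
Proof.
move=> acf; have [r r0 fr] := acf 1 ltr01.
have near1 x y : c <= x -> x <= y -> y <= d -> y - x < r -> `|f y - f x| < 1.
  move=> cx xy yd yx; have := fr _ _ _ (chain1 cx xy yd).
  by rewrite !big_ord1; exact.
have bnd n x : c <= x -> x <= d -> x <= c + n%:R * (r / 2) ->
    `|f x| <= `|f c| + n%:R.
  elim: n x => [|n IH] x cx xd; rewrite ?mul0r ?addr0.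
    by move=> xc; have -> : x = c by apply/eqP; rewrite eq_le xc cx.
  move=> xn; set z := Num.max c (x - r / 2).
  have [cz zx] : c <= z /\ z <= x by rewrite /z le_max ge_max; lra.
  have zn : z <= c + n%:R * (r / 2).
    rewrite /z ge_max; move: xn; rewrite -natr1 mulrDl mul1r => xn.
    by rewrite lerDl mulr_ge0//=; lra.
  have xz : x - r / 2 <= z by rewrite /z le_max lexx orbT.
  have := near1 z x cz zx xd; have := IH z cz (le_trans zx xd) zn.
  move=> fz /(_ ltac:(lra)) fxz.
  have -> : f x = f z + (f x - f z) by ring.
  by apply: le_trans (ler_normD _ _) _; rewrite -natr1; lra.
set n := (Num.truncn ((d - c) / (r / 2))).+1.
exists (`|f c| + n%:R) => [|x cx xd]; first by rewrite addr_ge0.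
apply: bnd => //; apply: le_trans xd _; rewrite -lerBlDl -ler_pdivrMr; last lra.
by apply/ltW; rewrite truncnS_gt.
Qed.

Lemma acD (R : realType) (c d : R) (f g : R -> R) :
  ac c d f -> ac c d g -> ac c d (fun x => f x + g x).
Proof.
move=> acf acg; apply: (ac_le acf acg ler01) => x y _ _ _; rewrite mul1r.
by rewrite (_ : _ - _ = (f y - f x) + (g y - g x)) ?ler_normD//; ring.
Qed.

Lemma acM (R : realType) (c d : R) (f g : R -> R) :
  ac c d f -> ac c d g -> ac c d (fun x => f x * g x).
Proof.
move=> acf acg; have [M M0 fM] := ac_bounded acf.
have [L L0 gL] := ac_bounded acg.
apply: (ac_le (K := M + L) acf acg) => [|x y cx xy yd]; first exact: addr_ge0.
rewrite (_ : _ - _ = f y * (g y - g x) + (f y - f x) * g x); last by ring.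
apply: le_trans (ler_normD _ _) _; rewrite !normrM mulrDl.
have := fM y (le_trans cx xy) yd; have := gL x cx (le_trans xy yd).
move=> gx fy; apply: lerD; first by rewrite ler_pM// lerDr.
by rewrite mulrC ler_pM// lerDl.
Qed.

(** exp is Lipschitz on bounded sets, because
exp b - exp a = exp b (1 - exp (a - b)) <= exp b (b - a). *)
Lemma ac_expR (R : realType) (c d : R) (f : R -> R) :
  ac c d f -> ac c d (fun x => expR (f x)).
Proof.
move=> acf; have [M M0 fM] := ac_bounded acf.
apply: (ac_le (K := expR M) acf acf) => [|x y cx xy yd]; first exact: expR_ge0.
have lip a b : b <= M -> expR b - expR a <= expR M * `|b - a|.
  move=> bM; rewrite (_ : _ - _ = expR b * (1 - expR (a - b))); last first.
    by rewrite mulrBr mulr1 -expRD subrKC.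
  apply: le_trans (_ : expR b * (b - a) <= _).
    by rewrite ler_wpM2l ?expR_ge0//; have := expR_ge1Dx (a - b); lra.
  apply: le_trans (_ : expR b * `|b - a| <= _).
    by rewrite ler_wpM2l ?expR_ge0// ler_norm.
  by rewrite ler_wpM2r// ler_expR.
have fx := le_trans (ler_norm _) (fM x cx (le_trans xy yd)).
have fy := le_trans (ler_norm _) (fM y (le_trans cx xy) yd).
apply: le_trans (_ : expR M * `|f y - f x| <= _).
  by rewrite ler_norml lerNl opprB lip// andbT -[X in _ * X]distrC; exact: lip.
by rewrite ler_wpM2l ?expR_ge0// lerDl.
Qed.

Lemma acZ (R : realType) (c d k : R) (f : R -> R) :
  ac c d f -> ac c d (fun x => k * f x).
Proof.
move=> acf; apply: acM => //; apply: (ac_lipschitz (lexx 0)) => *.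
by rewrite subrr normr0 mul0r.
Qed.

(** For sg = 1 this bounds E d by E c and for sg = -1 it bounds E c by E d.  The
function sg E exp (- sg H) is nonincreasing, since its derivative is
(sg E' - H' E) exp (- sg H). *)
Lemma ac_gronwall (R : realType) (c d sg : R) (E H : R -> R) : c <= d ->
  ac c d E -> ac c d H -> sg ^+ 2 = 1 ->
  {ae lebesgue_measure, forall x, c < x < d ->
    [/\ derivable E x 1, derivable H x 1 & `|derive1 E x| <= derive1 H x * E x]} ->
  sg * E d * expR (- sg * H d) <= sg * E c * expR (- sg * H c).
Proof.
move=> cd acE acH sg2 hyp.
pose G x := sg * E x * expR (- sg * H x).
have acG : ac c d G by apply: acM; [exact: acZ | apply: ac_expR; exact: acZ].
apply: (ac_nonincreasing cd acG); move: hyp.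
apply: filterS; first exact: (ae_filter_ringOfSetsType lebesgue_measure).
move=> x hx /hx[dE dH EH].
have iE : is_derive x 1 E (derive1 E x) by rewrite derive1E; exact: derivableP.
have iH : is_derive x 1 H (derive1 H x) by rewrite derive1E; exact: derivableP.
have iG : is_derive x 1 G ((sg * derive1 E x - derive1 H x * E x) * expR (- sg * H x)).
  have iH' : is_derive x 1 (cst (- sg) * H) (- sg * derive1 H x).
    by apply: is_derive_eq; rewrite !scaler0 addr0.
  have ie := is_derive1_comp (is_derive_expR _) iH'.
  have -> : G = cst sg * E * (expR \o (cst (- sg) * H)) by [].
  apply: is_derive_eq; rewrite /= !fctE /cst /= !scaler0 addr0 /GRing.scale /=.
  by move: sg2; rewrite expr2 => sg2; ring: sg2.
have := @derive_val _ _ _ _ _ _ _ iG; have := @ex_derive _ _ _ _ _ _ _ iG.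
move=> dG G'; split=> //; rewrite derive1E G' mulr_le0_ge0 ?expR_ge0// subr_le0.
apply: le_trans EH; apply: le_trans (ler_norm _) _.
rewrite normrM (_ : `|sg| = 1) ?mul1r//; apply/eqP.
by rewrite -sqrp_eq1// -normrX sg2 normr1.
Qed.

(** * Primitives of integrable functions *)

(** Absolute continuity of the integral gives the first property and Lebesgue
differentiation the last. *)
Lemma integral_primitive (R : realType) (h : R -> R) :
  lebesgue_measure.-integrable setT (EFin \o h) -> (forall x, 0 <= h x) ->
  exists H : R -> R, [/\ forall c d, ac c d H,
    exists B : R, forall x y, H y - H x <= B &
    {ae lebesgue_measure, forall x, derivable H x 1 /\ derive1 H x = h x}].
Proof.
move=> hi h0.
have hiS A : measurable A -> lebesgue_measure.-integrable A (EFin \o h).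
  by move=> mA; apply: integrableS hi.
pose H x := Rintegral lebesgue_measure `]-oo, x]%classic h.
have HB x y : x <= y -> H y - H x = Rintegral lebesgue_measure `]x, y]%classic h.
  move=> xy; apply: Rintegral_itvB; rewrite ?bnd_simp//; exact: hiS.
exists H; split.
- move=> c d e e0; have [r [r0 hr]] := integral_normr_continuous hi e0.
  exists r => // n u v ch sr; pose F i := `]u i, v i]%classic.
  have mF i : measurable (F i) by exact: measurable_itv.
  have mU : measurable (\big[setU/set0]_(i < n) F i).
    by apply: bigsetU_measurable => i _; exact: mF.
  have muU : (lebesgue_measure (\big[setU/set0]_(i < n) F i) < r%:E)%E.
    by rewrite /F (chain_measure ch) lte_fin.
  apply: le_lt_trans (hr _ mU muU).
  under [X in _ <= X]eq_Rintegral do rewrite ger0_norm//.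
  have -> : \sum_(i < n) `|H (v i) - H (u i)| = \sum_(i < n)
      Rintegral lebesgue_measure (F i) h.
    apply: eq_bigr => i _; have [uv _] := ch; have [_ uvi _] := uv i (ltn_ord i).
    by rewrite HB// ger0_norm// Rintegral_ge0.
  rewrite /Rintegral -(big_mkord xpredT F) integral_bigsetU_EFin//.
  - rewrite big_mkord sum_fine// => i _.
    by apply: integrable_fin_num; [exact: mF | exact: hiS (mF i)].
  - exact: iota_uniq.
  - by apply: sub_trivIset (chain_trivIset ch) => i /=; rewrite mem_index_iota.
  - by rewrite big_mkord; apply: measurable_int (hiS _ mU).
- exists (Rintegral lebesgue_measure setT h) => x y; case: (leP x y) => xy.
    rewrite HB//; apply: fine_le.
    - by apply: integrable_fin_num => //; exact: (hiS _ (measurable_itv _)).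
    - exact: integrable_fin_num.
    - apply: ge0_subset_integral => //; first exact: measurable_int hi.
      by move=> t _; rewrite lee_fin.
  apply: (@le_trans _ _ 0 (H y - H x)); last exact: Rintegral_ge0.
  by rewrite -opprB oppr_le0 (HB _ _ (ltW xy)) Rintegral_ge0.
- apply: (FTC1Ny (f := h)); first by move=> y; exact: hiS.
  by apply: open_integrable_locally => //; exact: openT.
Qed.

(** * The energy of a solution *)

(** The derivative is bounded, hence f is Lipschitz by the mean value theorem. *)
Lemma ac_of_derive (R : realType) (c d : R) (f : R -> R) :
  (forall x, c <= x -> x <= d -> derivable f x 1) -> ac c d (derive1 f) ->
  ac c d f.
Proof.
move=> df acf; have [M M0 fM] := ac_bounded acf.
apply: (ac_lipschitz M0) => x y cx xy yd.
have id z : z \in `]x, y[ -> is_derive z 1 f (derive1 f z).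
  rewrite in_itv/= => /andP[xz zy]; rewrite derive1E; apply: derivableP.
  by apply: df; lra.
have cf : {within `[x, y], continuous f}.
  apply: derivable_within_continuous => z; rewrite in_itv/= => /andP[xz zy].
  by apply: df; lra.
have [z /[!in_itv]/= /andP[xz zy] ->] := MVT_segment xy id cf.
rewrite normrM [X in _ * X]ger0_norm ?subr_ge0// ler_wpM2r ?subr_ge0//.
by apply: fM; lra.
Qed.

Lemma abs_continuous_ac (R : realType) (c d : R) (f : R -> R[i]) :
  abs_continuous c d f ->
  ac c d (fun x => complex.Re (f x)) /\ ac c d (fun x => complex.Im (f x)).
Proof.
move=> acf; split=> e /acf[r r0 H]; exists r => // n u v [uv vu] sr;
  apply: le_lt_trans (H n u v uv vu sr); apply: ler_sum => i _.
  case: (f (v i)) (f (u i)) => [a b] [a' b'] /=.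
  by rewrite -[leLHS]sqrtr_sqr ler_wsqrtr// lerDl sqr_ge0.
case: (f (v i)) (f (u i)) => [a b] [a' b'] /=.
by rewrite -[leLHS]sqrtr_sqr ler_wsqrtr// lerDr sqr_ge0.
Qed.

Definition sqmod (R : realType) (z : R[i]) : R :=
  complex.Re z ^+ 2 + complex.Im z ^+ 2.

Lemma sqmod_ge0 (R : realType) (z : R[i]) : 0 <= sqmod z.
Proof. by rewrite addr_ge0// sqr_ge0. Qed.

Lemma sqmod_eq0 (R : realType) (z : R[i]) : (sqmod z == 0) = (z == 0).
Proof.
by case: z => a b; rewrite /sqmod/= paddr_eq0 ?sqr_ge0// !sqrf_eq0 eq_complex.
Qed.

(** [sl_solution] without square integrability: a class that is closed under
linear combinations by the rules of calculus alone, and in which initial value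
problems have at most one solution. *)
Definition sl_weak (R : realType) (q : R -> R[i]) (lam : R[i]) (s t : R)
    (y : R -> R[i]) : Prop :=
  [/\ forall x, s < x < t -> cderivable y x,
      forall c d, s < c -> c < d -> d < t -> abs_continuous c d (cderiv y),
      lim_exists s^'+ y /\ lim_exists s^'+ (cderiv y),
      lim_exists t^'- y /\ lim_exists t^'- (cderiv y) &
      {ae @lebesgue_measure R, forall x, s < x < t ->
        cderivable (cderiv y) x /\ sl_ell q y x = lam * y x}].

Lemma sl_solution_weak (R : realType) (q : R -> R[i]) (lam : R[i]) (s t : R)
    (y : R -> R[i]) : sl_solution q lam s t y -> sl_weak q lam s t y.
Proof. by case=> -[*]; split. Qed.

Definition energy (R : realType) (y : R -> R[i]) (x : R) : R :=
  sqmod (y x) + sqmod (cderiv y x).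

Lemma energy_ge0 (R : realType) (y : R -> R[i]) (x : R) : 0 <= energy y x.
Proof. by rewrite addr_ge0// sqmod_ge0. Qed.

(** The growth rate of the energy: quadratic in q, hence integrable for q in L^2
over a bounded interval.  It is built on a Borel representative of q and extended
by 0, so that its primitive is defined on the whole line. *)
Lemma L2_majorant (R : realType) (s t : R) (C : R) (q : R -> R[i]) :
  in_L2 `]s, t[ q -> 0 <= C ->
  exists h : R -> R, [/\ lebesgue_measure.-integrable setT (EFin \o h),
    forall x, 0 <= h x &
    {ae lebesgue_measure, forall x, s < x < t -> h x = C + 2 * sqmod (q x)}].
Proof.
move=> [g [mg1 mg2 gi qg]] C0.
pose h x := C + 2 * (complex.Re (g x) ^+ 2 + complex.Im (g x) ^+ 2).
exists (h \_ `]s, t[); split.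
- suff hi : lebesgue_measure.-integrable `]s, t[ (EFin \o h).
    rewrite -restrict_EFin; apply/integrable_restrict => //=; rewrite setTI//.
  pose k x := complex.Re (g x) ^+ 2 + complex.Im (g x) ^+ 2.
  have mst : measurable `]s, t[%classic by exact: (measurable_itv `]s, t[).
  have ki : lebesgue_measure.-integrable `]s, t[ (EFin \o k).
    apply/integrableP; split.
      by apply/measurable_EFinP/measurable_funD; exact: measurable_funX.
    under eq_integral do rewrite /= ger0_norm ?addr_ge0 ?sqr_ge0//.
    exact: gi.
  have Ci : lebesgue_measure.-integrable `]s, t[ (EFin \o cst C).
    apply: measurable_bounded_integrable => //.
      apply: le_lt_trans (_ : (`|(t - s)%:E| < +oo)%E); last by rewrite ltry.
      have := lebesgue_measure_itv `]s, t[; rewrite /= => ->.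
      by case: ifP => // _; rewrite lee_fin ler_norm.
    exact: bounded_cst.
  have := (fun m => integrableD m Ci (integrableZl m 2 ki)) mst.
  by congr integrable; apply/funext.
- move=> x; rewrite patchE; case: ifP => // _.
  by rewrite /h addr_ge0// mulr_ge0// addr_ge0// sqr_ge0.
- move: qg; apply: filterS; first exact: (ae_filter_ringOfSetsType lebesgue_measure).
  move=> x qg xst; rewrite patchE mem_set; last by rewrite /= in_itv.
  by rewrite /h qg// /= in_itv.
Qed.

(** The left-hand side is the derivative of the energy when y'' = w y with
w = q - lam; the bound combines 2|y p| <= y^2 + p^2, 2|p w y| <= p^2 + |w y|^2
and |w|^2 <= 2|q|^2 + 2|lam|^2. *)
Lemma energy_deriv_bound (R : realType) (y1 y2 p1 p2 q1 q2 l1 l2 : R) :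
  `|2 * (y1 * p1 + y2 * p2 + p1 * ((q1 - l1) * y1 - (q2 - l2) * y2)
                           + p2 * ((q1 - l1) * y2 + (q2 - l2) * y1))|
  <= (2 + 2 * (l1 ^+ 2 + l2 ^+ 2) + 2 * (q1 ^+ 2 + q2 ^+ 2))
     * (y1 ^+ 2 + y2 ^+ 2 + (p1 ^+ 2 + p2 ^+ 2)).
Proof.
set r1 := _ * y1 - _; set r2 := _ * y2 + _.
have W : r1 ^+ 2 + r2 ^+ 2 = ((q1 - l1) ^+ 2 + (q2 - l2) ^+ 2) * (y1 ^+ 2 + y2 ^+ 2).
  by rewrite /r1 /r2; ring.
have : r1 ^+ 2 + r2 ^+ 2 <=
   2 * (q1 ^+ 2 + q2 ^+ 2 + (l1 ^+ 2 + l2 ^+ 2))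
   * (y1 ^+ 2 + y2 ^+ 2 + (p1 ^+ 2 + p2 ^+ 2)).
  rewrite W; apply: ler_pM; rewrite ?addr_ge0 ?sqr_ge0//; last first.
    by rewrite lerDl addr_ge0 ?sqr_ge0.
  have := sqr_ge0 (q1 + l1); have := sqr_ge0 (q2 + l2); lra.
have := sqr_ge0 (y1 - p1); have := sqr_ge0 (y2 - p2).
have := sqr_ge0 (y1 + p1); have := sqr_ge0 (y2 + p2).
have := sqr_ge0 (r1 - p1); have := sqr_ge0 (r2 - p2).
have := sqr_ge0 (r1 + p1); have := sqr_ge0 (r2 + p2).
have := sqr_ge0 y1; have := sqr_ge0 y2.
move: r1 r2 {W} => r1 r2; rewrite ler_norml => *.
apply/andP; split; lra.
Qed.

Lemma energy_is_derive (R : realType) (y : R -> R[i]) (x : R) :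
  cderivable y x -> cderivable (cderiv y) x ->
  is_derive x 1 (energy y) (2 * (complex.Re (y x) * complex.Re (cderiv y x)
     + complex.Im (y x) * complex.Im (cderiv y x)
     + complex.Re (cderiv y x) * complex.Re (cderiv (cderiv y) x)
     + complex.Im (cderiv y x) * complex.Im (cderiv (cderiv y) x))).
Proof.
have sq (f : R -> R) : derivable f x 1 ->
    is_derive x 1 (fun t => f t ^+ 2) (2 * (f x * derive1 f x)).
  move=> df; have idf : is_derive x 1 f (derive1 f x).
    by rewrite derive1E; exact: derivableP.
  move: (derive1 f x) idf => f' idf.
  have -> : 2 * (f x * f') = f x *: f' + f x *: f' by rewrite mulr_natl mulr2n.
  exact: is_deriveM.
move=> [/sq d1 /sq d2] [/sq d3 /sq d4].
by rewrite !mulrDr -addrA; exact: is_deriveD (is_deriveD d1 d2) (is_deriveD d3 d4).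
Qed.

(** The constant is the same for all c and d, since the primitive of the rate
has bounded increments: this is what allows c or d to tend to an end of the
interval. *)
Lemma energy_comparison (R : realType) (q : R -> R[i]) (lam : R[i]) (s t : R)
    (y : R -> R[i]) :
  in_L2 `]s, t[ q -> sl_weak q lam s t y ->
  exists2 K : R, 0 < K & forall c d, s < c -> c <= d -> d < t ->
    energy y d <= K * energy y c /\ energy y c <= K * energy y d.
Proof.
move=> q_L2 [dy acy _ _ eqy].
have [|h [hi h0 hq]] := @L2_majorant R s t (2 + 2 * sqmod lam) q q_L2.
  by rewrite addr_ge0// mulr_ge0// sqmod_ge0.
have [H [acH [B HB] dH]] := integral_primitive hi h0.
exists (expR B) => [|c d sc]; first exact: expR_gt0.
have K1 : 1 <= expR B by rewrite -expR0 ler_expR -(subrr (H 0)).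
rewrite le_eqVlt => /predU1P[-> dt|cd dt].
  by split; rewrite ler_peMl// energy_ge0.
have acE : ac c d (energy y).
  have [ac1 ac2] := abs_continuous_ac (acy _ _ sc cd dt).
  have ac3 : ac c d (fun x => complex.Re (y x)).
    by apply: ac_of_derive ac1 => x cx xd; have [|? _] := dy x; first lra.
  have ac4 : ac c d (fun x => complex.Im (y x)).
    by apply: ac_of_derive ac2 => x cx xd; have [|_ ?] := dy x; first lra.
  by apply: acD; apply: acD; apply: acM.
have ae : {ae lebesgue_measure, forall x, c < x < d ->
    [/\ derivable (energy y) x 1, derivable H x 1 &
    `|derive1 (energy y) x| <= derive1 H x * energy y x]}.
  move: hq dH eqy; apply: filterS3.
    exact: (ae_filter_ringOfSetsType lebesgue_measure).
  move=> x hq [dHx Hx] eqx cxd; have sxt : s < x < t by lra.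
  have [dpx /eqP ely] := eqx sxt; have iE := energy_is_derive (dy x sxt) dpx.
  split=> //.
  rewrite derive1E (@derive_val _ _ _ _ _ _ _ iE) Hx (hq sxt) /energy /sqmod.
  move: ely; rewrite /sl_ell.
  case: (cderiv (cderiv y) x) => r1 r2; case: (y x) (cderiv y x) (q x) lam {eqx hq}
    => [y1 y2] [p1 p2] [q1 q2] [l1 l2] /=.
  rewrite eq_complex /= => /andP[/eqP e1 /eqP e2].
  have -> : r1 = (q1 - l1) * y1 - (q2 - l2) * y2 by lra.
  have -> : r2 = (q1 - l1) * y2 + (q2 - l2) * y1 by lra.
  exact: energy_deriv_bound.
have HB' : expR (H d - H c) <= expR B by rewrite ler_expR.
have E0 x := energy_ge0 y x.
split; apply: le_trans (ler_wpM2r (E0 _) HB').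
  have := ac_gronwall (sg := 1) (ltW cd) acE (acH c d) (expr1n _ _) ae.
  rewrite !mul1r !mulN1r => G.
  have := ler_wpM2r (expR_ge0 (H d)) G.
  by rewrite -!mulrA -!expRD addNr expR0 mulr1 [leRHS]mulrC addrC.
have := ac_gronwall (sg := -1) (ltW cd) acE (acH c d).
rewrite sqrrN expr1n => /(_ erefl ae).
rewrite !mulN1r opprK !mul1r !mulNr lerN2 => G.
have := ler_wpM2r (expR_ge0 (- H c)) G.
by rewrite -!mulrA -!expRD subrr expR0 mulr1 [leRHS]mulrC.
Qed.

Lemma cvg_energy (R : realType) (F : set_system R) {FF : ProperFilter F}
    (y : R -> R[i]) :
  lim_exists F y -> lim_exists F (cderiv y) ->
  energy y x @[x --> F] --> sqmod (climit F y) + sqmod (climit F (cderiv y)).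
Proof.
move=> [c1 c2] [c3 c4].
have sq (f : R -> R) : cvg (f x @[x --> F]) ->
    f x ^+ 2 @[x --> F] --> lim (f x @[x --> F]) ^+ 2.
  by move=> cf; rewrite expr2; under eq_fun do rewrite expr2; exact: cvgM.
by apply: cvgD; apply: cvgD; exact: sq.
Qed.

Lemma weak_zero_left (R : realType) (q : R -> R[i]) (lam : R[i]) (s t : R)
    (y : R -> R[i]) : in_L2 `]s, t[ q -> sl_weak q lam s t y ->
  climit s^'+ y = 0 -> climit s^'+ (cderiv y) = 0 ->
  forall x, s < x < t -> y x = 0.
Proof.
move=> q_L2 wy l0 l1 x /andP[sx xt].
have [K K0 HK] := energy_comparison q_L2 wy.
have [_ _ [cy cy'] _ _] := wy.
have := cvg_energy (FF := at_right_proper_filter s) cy cy'.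
rewrite l0 l1 /sqmod /= !expr0n /= !addr0 => cE.
have E0 : energy y x <= 0.
  have cKE : K * energy y c @[c --> s^'+] --> K * 0.
    by apply: cvgM => //; exact: cvg_cst.
  rewrite mulr0 in cKE; apply: (cvgr_to_ge cKE); near=> c.
  have sc : s < c by near: c; exact: nbhs_right_gt.
  have cx : c <= x by near: c; exact: nbhs_right_le.
  by have [] := HK c x sc cx xt.
have : sqmod (y x) <= 0 by apply: le_trans E0; rewrite lerDl sqmod_ge0.
by move=> y0; apply/eqP; rewrite -sqmod_eq0 eq_le y0 sqmod_ge0.
Unshelve. all: by end_near. Qed.

Lemma weak_zero_right (R : realType) (q : R -> R[i]) (lam : R[i]) (s t : R)
    (y : R -> R[i]) : in_L2 `]s, t[ q -> sl_weak q lam s t y ->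
  climit t^'- y = 0 -> climit t^'- (cderiv y) = 0 ->
  forall x, s < x < t -> y x = 0.
Proof.
move=> q_L2 wy l0 l1 x /andP[sx xt].
have [K K0 HK] := energy_comparison q_L2 wy.
have [_ _ _ [cy cy'] _] := wy.
have := cvg_energy (FF := at_left_proper_filter t) cy cy'.
rewrite l0 l1 /sqmod /= !expr0n /= !addr0 => cE.
have E0 : energy y x <= 0.
  have cKE : K * energy y c @[c --> t^'-] --> K * 0.
    by apply: cvgM => //; exact: cvg_cst.
  rewrite mulr0 in cKE; apply: (cvgr_to_ge cKE); near=> c.
  have sc : c < t by near: c; exact: nbhs_left_lt.
  have cx : x <= c by near: c; exact: nbhs_left_ge.
  by have [] := HK x c sx cx sc.
have : sqmod (y x) <= 0 by apply: le_trans E0; rewrite lerDl sqmod_ge0.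
by move=> y0; apply/eqP; rewrite -sqmod_eq0 eq_le y0 sqmod_ge0.
Unshelve. all: by end_near. Qed.

(** * Linearity and locality of limits, derivatives and solutions *)

Definition lincomb (R : realType) (k : R[i]) (y z : R -> R[i]) : R -> R[i] :=
  fun x => k * y x + z x.

Lemma ReZD (R : realType) (k a b : R[i]) : complex.Re (k * a + b) =
  complex.Re k * complex.Re a + (- complex.Im k * complex.Im a + complex.Re b).
Proof. by case: k a b => [k1 k2] [a1 a2] [b1 b2] /=; ring. Qed.

Lemma ImZD (R : realType) (k a b : R[i]) : complex.Im (k * a + b) =
  complex.Re k * complex.Im a + (complex.Im k * complex.Re a + complex.Im b).
Proof. by case: k a b => [k1 k2] [a1 a2] [b1 b2] /=; ring. Qed.

(** The componentwise limit as one relation, in which existence and value of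
the limit are proved together. *)
Definition ccvg (R : realType) (F : set_system R) (f : R -> R[i]) (l : R[i]) : Prop :=
  (complex.Re (f x) @[x --> F] --> complex.Re l) /\
  (complex.Im (f x) @[x --> F] --> complex.Im l).

Lemma ccvg_climit (R : realType) (F : set_system R) (f : R -> R[i]) :
  lim_exists F f -> ccvg F f (climit F f).
Proof. by case. Qed.

Lemma ccvg_lim (R : realType) (F : set_system R) {FF : ProperFilter F}
    (f : R -> R[i]) l : ccvg F f l -> lim_exists F f /\ climit F f = l.
Proof.
move=> [c1 c2]; split.
  by split; apply/cvg_ex; [exists (complex.Re l) | exists (complex.Im l)].
by case: l c1 c2 => l1 l2 c1 c2; congr Complex; exact: cvg_lim.
Qed.

Lemma ccvg_lincomb (R : realType) (F : set_system R) {FF : ProperFilter F}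
    k (f g : R -> R[i]) l m :
  ccvg F f l -> ccvg F g m -> ccvg F (lincomb k f g) (k * l + m).
Proof.
move=> [f1 f2] [g1 g2]; rewrite /ccvg ReZD ImZD; split.
  under eq_fun do rewrite ReZD.
  by apply: cvgD; [apply: cvgM|apply: cvgD => //; apply: cvgM] => //; exact: cvg_cst.
under eq_fun do rewrite ImZD.
by apply: cvgD; [apply: cvgM|apply: cvgD => //; apply: cvgM] => //; exact: cvg_cst.
Qed.

Lemma ccvg_near (R : realType) (F : set_system R) {FF : Filter F}
    (f g : R -> R[i]) l : {near F, f =1 g} -> ccvg F f l -> ccvg F g l.
Proof.
move=> fg [c1 c2]; split; [apply: cvg_trans c1 | apply: cvg_trans c2];
  by apply: near_eq_cvg; apply: filterS fg => x ->.
Qed.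

Lemma is_derive_comb (R : realType) (a b x : R) (f g h : R -> R) :
  derivable f x 1 -> derivable g x 1 -> derivable h x 1 ->
  is_derive x 1 (fun t => a * f t + (b * g t + h t))
    (a * derive1 f x + (b * derive1 g x + derive1 h x)).
Proof.
have idE (f' : R -> R) : derivable f' x 1 -> is_derive x 1 f' (derive1 f' x).
  by move=> df; rewrite derive1E; exact: derivableP.
move=> /idE df /idE dg /idE dh.
have -> : (fun t => a * f t + (b * g t + h t)) = cst a * f + (cst b * g + h) by [].
move: (derive1 f x) (derive1 g x) (derive1 h x) df dg dh => f1 g1 h1 df dg dh.
have da : is_derive x 1 (cst a * f) (a * f1).
  by apply: is_derive_eq; rewrite scaler0 addr0.
have db : is_derive x 1 (cst b * g) (b * g1).
  by apply: is_derive_eq; rewrite scaler0 addr0.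
exact: is_deriveD.
Qed.

Lemma cderiv_lincomb (R : realType) k (y z : R -> R[i]) x :
  cderivable y x -> cderivable z x ->
  cderivable (lincomb k y z) x /\
  cderiv (lincomb k y z) x = k * cderiv y x + cderiv z x.
Proof.
move=> [d1 d2] [d3 d4].
have eRe := funext (fun t => ReZD k (y t) (z t)).
have eIm := funext (fun t => ImZD k (y t) (z t)).
have dRe := is_derive_comb (complex.Re k) (- complex.Im k) d1 d2 d3.
have dIm := is_derive_comb (complex.Re k) (complex.Im k) d2 d1 d4.
rewrite -eRe in dRe; rewrite -eIm in dIm.
split.
  split; first exact: (@ex_derive _ _ _ _ _ _ _ dRe).
  exact: (@ex_derive _ _ _ _ _ _ _ dIm).
apply/eqP; rewrite eq_complex; apply/andP; split; apply/eqP.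
  rewrite ReZD; exact: etrans (derive1E _ _) (@derive_val _ _ _ _ _ _ _ dRe).
rewrite ImZD; exact: etrans (derive1E _ _) (@derive_val _ _ _ _ _ _ _ dIm).
Qed.

Lemma cderiv_near (R : realType) (y z : R -> R[i]) (x : R) :
  {near x, y =1 z} ->
  (cderivable y x -> cderivable z x) /\ cderiv y x = cderiv z x.
Proof.
move=> yz.
have yzR : {near x, (fun t => complex.Re (y t)) =1 (fun t => complex.Re (z t))}.
  by apply: filterS yz => t ->.
have yzI : {near x, (fun t => complex.Im (y t)) =1 (fun t => complex.Im (z t))}.
  by apply: filterS yz => t ->.
split; last by rewrite /cderiv !derive1E (near_eq_derive _ yzR) (near_eq_derive _ yzI).
by move=> [d1 d2]; split; [apply: near_eq_derivable d1 | apply: near_eq_derivable d2].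
Qed.

Lemma near_itv_oo (R : realType) (s t x : R) (P : R -> Prop) : s < x < t ->
  (forall z, s < z < t -> P z) -> \near x, P x.
Proof.
move=> /andP[sx xt] H; near=> z; apply: H; apply/andP; split; near: z.
  exact: lt_nbhsr.
exact: lt_nbhsl.
Unshelve. all: by end_near. Qed.

Lemma near_right_oo (R : realType) (s t : R) (P : R -> Prop) : s < t ->
  (forall z, s < z < t -> P z) -> \forall x \near s^'+, P x.
Proof.
move=> st H; near=> z; apply: H; apply/andP; split; near: z.
  exact: nbhs_right_gt.
exact: nbhs_right_lt.
Unshelve. all: by end_near. Qed.

Lemma near_left_oo (R : realType) (s t : R) (P : R -> Prop) : s < t ->
  (forall z, s < z < t -> P z) -> \forall x \near t^'-, P x.
Proof.
move=> st H; near=> z; apply: H; apply/andP; split; near: z.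
  exact: nbhs_left_gt.
exact: nbhs_left_lt.
Unshelve. all: by end_near. Qed.

Lemma abs_continuous_lincomb (R : realType) (c d : R) k (f g h : R -> R[i]) :
  (forall x, c <= x <= d -> h x = k * f x + g x) ->
  abs_continuous c d f -> abs_continuous c d g -> abs_continuous c d h.
Proof.
move=> hE acf acg e e0.
pose K := ComplexField.Normc.normc k.
have K0 : 0 <= K by rewrite {}/K; case: k {hE} => k1 k2; exact: sqrtr_ge0.
have e1 : 0 < e / (2 * (K + 1)) by rewrite divr_gt0//; lra.
have [r r0 fr] := acf _ e1.
have [s s0 gs] := acg (e / 2) ltac:(lra).
exists (Num.min r s) => [|n u v uv vu]; first by rewrite lt_min r0.
rewrite lt_min => /andP[/(fr _ _ _ uv vu) fe /(gs _ _ _ uv vu) ge].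
set sf := \sum_(i < n) _ in fe; set sg := \sum_(i < n) _ in ge.
apply: (@le_lt_trans _ _ (K * sf + sg)).
  rewrite mulr_sumr -big_split/=; apply: ler_sum => i _.
  have [cu uv' vd] := uv i (ltn_ord i).
  rewrite !hE ?cu ?vd ?(le_trans cu uv') ?(le_trans uv' vd)//.
  rewrite (_ : _ - _ = k * (f (v i) - f (u i)) + (g (v i) - g (u i))); last by ring.
  by apply: le_trans (le_normcD _ _) _; rewrite ComplexField.Normc.normcM.
apply: (@le_lt_trans _ _ (K * (e / (2 * (K + 1))) + sg)).
  by rewrite lerD2r ler_wpM2l// ltW.
rewrite (_ : K * _ = e / 2 * (K / (K + 1))); last by field; lra.
have : e / 2 * (K / (K + 1)) <= e / 2 by rewrite ger_pMr ?ler_pdivrMr; lra.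
lra.
Qed.

Lemma climit_near (R : realType) (F : set_system R) {FF : ProperFilter F}
    (f g : R -> R[i]) : {near F, f =1 g} -> lim_exists F f ->
  lim_exists F g /\ climit F g = climit F f.
Proof.
by move=> fg cf; apply: ccvg_lim; apply: ccvg_near fg _; exact: ccvg_climit.
Qed.

Lemma climit_lincomb (R : realType) (F : set_system R) {FF : ProperFilter F}
    k (f g : R -> R[i]) : lim_exists F f -> lim_exists F g ->
  lim_exists F (lincomb k f g) /\
  climit F (lincomb k f g) = k * climit F f + climit F g.
Proof.
by move=> cf cg; apply: ccvg_lim; apply: ccvg_lincomb; exact: ccvg_climit.
Qed.

(** What the filters of right neighbourhoods of s and of left neighbourhoods of
t have in common, so that each statement on limits at the ends of (s,t) is
proved once. *)
Definition borders (R : realType) (s t : R) (F : set_system R) : Prop :=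
  ProperFilter F /\
  forall P : R -> Prop, (forall z, s < z < t -> P z) -> \forall x \near F, P x.

Lemma borders_left (R : realType) (s t : R) : s < t -> borders s t s^'+.
Proof.
by move=> st; split=> [|P]; [exact: at_right_proper_filter | exact: near_right_oo].
Qed.

Lemma borders_right (R : realType) (s t : R) : s < t -> borders s t t^'-.
Proof.
by move=> st; split=> [|P]; [exact: at_left_proper_filter | exact: near_left_oo].
Qed.

Definition has_trace (R : realType) (F : set_system R) (y : R -> R[i]) : Prop :=
  lim_exists F y /\ lim_exists F (cderiv y).

Lemma trace_lincomb (R : realType) (s t : R) (F : set_system R) k (y z : R -> R[i]) :
  borders s t F ->
  (forall x, s < x < t -> cderivable y x) ->
  (forall x, s < x < t -> cderivable z x) ->
  has_trace F y -> has_trace F z ->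
  [/\ has_trace F (lincomb k y z),
      climit F (lincomb k y z) = k * climit F y + climit F z &
      climit F (cderiv (lincomb k y z))
      = k * climit F (cderiv y) + climit F (cderiv z)].
Proof.
move=> [FF HF] dy dz [cy cy'] [cz cz'].
have [l0 l0E] := climit_lincomb k cy cz; have [l1 l1E] := climit_lincomb k cy' cz'.
have : {near F, lincomb k (cderiv y) (cderiv z) =1 cderiv (lincomb k y z)}.
  by apply: HF => x xst; have [_ ->] := cderiv_lincomb k (dy x xst) (dz x xst).
by move=> /climit_near /(_ l1)[l2 l2E]; split=> //; rewrite l2E.
Qed.

Lemma trace_eq (R : realType) (s t : R) (F : set_system R) (y z : R -> R[i]) :
  borders s t F -> (forall x, s < x < t -> y x = z x) -> has_trace F y ->
  [/\ has_trace F z, climit F z = climit F y &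
      climit F (cderiv z) = climit F (cderiv y)].
Proof.
move=> [FF HF] yz [cy cy'].
have [l0 l0E] := climit_near (HF _ yz) cy.
have : {near F, cderiv y =1 cderiv z}.
  by apply: HF => x xst; have [_ ->] := cderiv_near (near_itv_oo xst yz).
by move=> /climit_near /(_ cy')[l1 l1E]; split.
Qed.

Lemma sl_weak_lincomb (R : realType) (q : R -> R[i]) lam s t k (y z : R -> R[i]) :
  s < t -> sl_weak q lam s t y -> sl_weak q lam s t z ->
  sl_weak q lam s t (lincomb k y z).
Proof.
move=> st [dy acy tys tyt ey] [dz acz tzs tzt ez].
have dl x : s < x < t -> cderivable (lincomb k y z) x /\
    cderiv (lincomb k y z) x = lincomb k (cderiv y) (cderiv z) x.
  by move=> xst; apply: cderiv_lincomb; [exact: dy | exact: dz].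
split.
- by move=> x /dl[].
- move=> c d sc cd dt; apply: (@abs_continuous_lincomb _ c d k (cderiv y) (cderiv z)).
  + by move=> x /andP[cx xd]; have [|_ ->//] := dl x; lra.
  + exact: acy.
  + exact: acz.
- by have [] := trace_lincomb k (borders_left st) dy dz tys tzs.
- by have [] := trace_lincomb k (borders_right st) dy dz tyt tzt.
- move: ey ez; apply: filterS2.
    exact: (ae_filter_ringOfSetsType lebesgue_measure).
  move=> x ey ez xst; have [dy' ely] := ey xst; have [dz' elz] := ez xst.
  have nearx : {near x, lincomb k (cderiv y) (cderiv z) =1 cderiv (lincomb k y z)}.
    by apply: (near_itv_oo xst) => w /dl[_ ->].
  have [d2 d2E] := cderiv_lincomb k dy' dz'.
  have [/(_ d2) d3 d3E] := cderiv_near nearx.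
  split=> //; rewrite /sl_ell -d3E d2E /lincomb.
  move: ely elz; rewrite /sl_ell.
  move: (cderiv (cderiv y) x) (cderiv (cderiv z) x) (q x) (y x) (z x).
  move=> y2 z2 Q Y Z ely elz.
  have -> : lam * (k * Y + Z) = k * (lam * Y) + lam * Z by ring.
  by rewrite -ely -elz; ring.
Qed.

Lemma in_L2_eq (R : realType) (s t : R) (f g : R -> R[i]) :
  (forall x, s < x < t -> f x = g x) -> in_L2 `]s, t[ f -> in_L2 `]s, t[ g.
Proof.
move=> fg [h [m1 m2 hi fh]]; exists h; split=> //.
move: fh; apply: filterS; first exact: (ae_filter_ringOfSetsType lebesgue_measure).
by move=> x fh xst; rewrite -fg ?fh//; move: xst; rewrite /= in_itv.
Qed.

Lemma sl_solution_eq (R : realType) (q : R -> R[i]) lam s t (y z : R -> R[i]) :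
  s < t -> (forall x, s < x < t -> y x = z x) ->
  sl_solution q lam s t y -> sl_solution q lam s t z.
Proof.
move=> st yz [[dy acy [y2 y'2 ly2] tys tyt] ey].
have dz x : s < x < t -> cderivable z x /\ cderiv y x = cderiv z x.
  move=> xst; have [H ->] := cderiv_near (near_itv_oo xst yz).
  by split=> //; exact/H/dy.
have dz' x : s < x < t -> (cderivable (cderiv y) x -> cderivable (cderiv z) x) /\
    cderiv (cderiv y) x = cderiv (cderiv z) x.
  by move=> xst; apply: cderiv_near; apply: (near_itv_oo xst) => w /dz[].
have lz x : s < x < t -> sl_ell q y x = sl_ell q z x.
  by move=> xst; have [_ e] := dz' x xst; rewrite /sl_ell e (yz x xst).
split; first split.
- by move=> x /dz[].
- move=> c d sc cd dt e /(acy c d sc cd dt)[r r0 H]; exists r => // n u v uv vu sr.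
  apply: le_lt_trans (H n u v uv vu sr); apply: ler_sum => i _.
  have [cu uvi vd] := uv i (ltn_ord i).
  have [|_ ->] := dz (u i); first lra.
  by have [|_ ->] := dz (v i); first lra.
- split; [exact: in_L2_eq y2 | | exact: in_L2_eq ly2].
  by apply: in_L2_eq y'2 => x /dz[].
- by have [] := trace_eq (borders_left st) yz tys.
- by have [] := trace_eq (borders_right st) yz tyt.
- move: ey; apply: filterS; first exact: (ae_filter_ringOfSetsType lebesgue_measure).
  move=> x ey xst; have [dy' ely] := ey xst.
  by split; [have [H _] := dz' x xst; exact: H | rewrite -lz// ely yz].
Qed.

Lemma in_L2_cst (R : realType) (s t : R) (c : R[i]) : in_L2 `]s, t[ (cst c).
Proof.
exists (cst c); split.
- exact: measurable_cst.
- exact: measurable_cst.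
- have := @integral_cst _ _ _ (@lebesgue_measure R) _ (measurable_itv `]s, t[)
    (sqmod c)%:E.
  rewrite /sqmod /cst => ->.
  have := lebesgue_measure_itv `]s, t[; rewrite /= => ->.
  by case: ifP => _; rewrite ?mule0 ?ltry// -EFinD -EFinM ltry.
- exact: aeW.
Qed.

Lemma cderiv_cst (R : realType) (c : R[i]) (x : R) :
  cderivable (cst c) x /\ cderiv (cst c) x = 0.
Proof.
split; first by split; exact: derivable_cst.
by rewrite /cderiv !derive1_cst.
Qed.

Lemma sl_solution_cst (R : realType) (q : R -> R[i]) lam s t (c : R[i]) :
  s < t -> (forall x, s < x < t -> q x * c = lam * c) ->
  sl_solution q lam s t (cst c).
Proof.
move=> st qc.
have E : cderiv (cst c) = cst 0 by apply/funext => x; have [_ ->] := cderiv_cst c x.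
have ell x : s < x < t -> cst (lam * c) x = sl_ell q (cst c) x.
  by move=> xst; rewrite /sl_ell E; have [_ ->] := cderiv_cst (0 : R[i]) x;
    rewrite oppr0 add0r qc.
have tr F : ProperFilter F -> has_trace F (cst c).
  have tr0 (FF : ProperFilter F) z : lim_exists F (cst z).
    by split; exact: is_cvg_cst.
  by move=> FF; split; rewrite ?E; exact: tr0.
split; first split.
- by move=> x _; have [] := cderiv_cst c x.
- move=> c' d _ _ _ e e0; exists 1 => // n u v _ _ _.
  rewrite big1// => i _; by rewrite E subrr ComplexField.Normc.normc0.
- split; [exact: in_L2_cst | rewrite E; exact: in_L2_cst | ].
  by apply: in_L2_eq ell _; exact: in_L2_cst.
- exact: tr.
- exact: tr.
- apply: aeW => x xst; split; last by rewrite -ell.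
  by rewrite E; have [] := cderiv_cst (0 : R[i]) x.
Qed.

(** * Dimension bounds from a faithful linear map *)

(** A linear subspace S of functions on which L is linear, and injective up to
equality on D.  The functions are total while only their values on D matter,
whence an equivalence in place of a trivial kernel. *)
Record faithful (R : realType) (m : nat) (D : set R) (S : set (R -> R[i]))
    (L : (R -> R[i]) -> 'rV[R[i]]_m) : Prop := Faithful {
  faithful_lincomb : forall k y z, S y -> S z -> S (lincomb k y z);
  faithful_linear : forall k y z, S y -> S z ->
    L (lincomb k y z) = k *: L y + L z;
  faithful_eq0 : forall y, S y -> L y = 0 <-> (forall x, D x -> y x = 0)
}.

Section faithful_theory.
Context (R : realType) (m : nat) (D : set R) (S : set (R -> R[i]))
  (L : (R -> R[i]) -> 'rV[R[i]]_m) (SL : faithful D S L).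

Let coord n (e : 'I_n -> R -> R[i]) : 'M[R[i]]_(n, m) := \matrix_i L (e i).

Let sumS n (k : 'rV[R[i]]_n) (e : 'I_n -> R -> R[i]) z :
  (forall i, S (e i)) -> S z ->
  S (fun x => \sum_(i < n) k 0 i * e i x + z x) /\
  L (fun x => \sum_(i < n) k 0 i * e i x + z x) = k *m coord e + L z.
Proof.
move=> + Sz; elim: n k e => [|n IH] k e Se.
  have -> : (fun x => \sum_(i < 0) k 0 i * e i x + z x) = z.
    by apply/funext => x; rewrite big_ord0 add0r.
  by split=> //; rewrite flatmx0 mulmx0 add0r.
have [IH1 IH2] := IH (\row_i k 0 (lift ord0 i)) (fun i => e (lift ord0 i))
  (fun i => Se _).
set w := (X in S X) in IH1 IH2.
have -> : (fun x => \sum_(i < n.+1) k 0 i * e i x + z x) =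
  lincomb (k 0 ord0) (e ord0) w.
  apply/funext => x; rewrite big_ord_recl /lincomb /w addrA.
  by congr (_ + _ + _); apply: eq_bigr => i _; rewrite mxE.
split; first exact: (faithful_lincomb SL).
rewrite (faithful_linear SL)// IH2 addrA; congr (_ + _).
rewrite !mulmx_sum_row big_ord_recl !rowK; congr (_ + _).
by apply: eq_bigr => i _; rewrite mxE !rowK.
Qed.

Let sumS0 n (k : 'rV[R[i]]_n) (e : 'I_n -> R -> R[i]) :
  (forall i, S (e i)) -> (0 < n)%N ->
  S (fun x => \sum_(i < n) k 0 i * e i x) /\
  L (fun x => \sum_(i < n) k 0 i * e i x) = k *m coord e.
Proof.
case: n k e => // n k e Se _.
have zE : lincomb (-1) (e ord0) (e ord0) = cst 0.
  by apply/funext => x; rewrite /lincomb mulN1r addNr.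
have Sz : S (cst 0) by rewrite -zE; exact: (faithful_lincomb SL).
have Lz : L (cst 0) = 0 by apply/(faithful_eq0 SL Sz).
have [] := sumS k Se Sz; rewrite Lz addr0.
have -> // : (fun x => \sum_(i < n.+1) k 0 i * e i x + cst 0 x) =
  (fun x => \sum_(i < n.+1) k 0 i * e i x).
by apply/funext => x; rewrite addr0.
Qed.

Let free_independent n (e : 'I_n -> R -> R[i]) : (forall i, S (e i)) ->
  row_free (coord e) <->
  forall k : 'I_n -> R[i], (forall x, D x -> \sum_(i < n) k i * e i x = 0) ->
    forall i, k i = 0.
Proof.
move=> Se; split=> [fr k k0 i | ind].
  have n0 : (0 < n)%N by case: n i {e k k0 Se fr} => [[]|].
  have [Sk Lk] := sumS0 (\row_j k j) Se n0.
  have /(faithful_eq0 SL Sk) : forall x, D x ->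
      \sum_(j < n) (\row_j k j) 0 j * e j x = 0.
    by move=> x Dx; rewrite -[RHS](k0 x Dx); apply: eq_bigr => j _; rewrite mxE.
  rewrite Lk => /eqP; rewrite mulmx_free_eq0// => /eqP /rowP/(_ i).
  by rewrite !mxE.
case: n e ind Se => [e _ _|n e ind Se]; first by rewrite /row_free flatmx0 mxrank0.
rewrite -kermx_eq0; apply/eqP/row_matrixP => j; rewrite row0.
set k := row j _.
have kM : k *m coord e = 0 by apply/sub_kermxP; exact: row_sub.
have [Sk Lk] := sumS0 k Se (ltn0Sn n); move: Lk; rewrite kM => Lk.
apply/rowP => i; rewrite [RHS]mxE; apply: (ind (fun i => k 0 i)) => x Dx.
exact: (proj1 (faithful_eq0 SL Sk) Lk).
Qed.

Lemma faithful_independent_le n (e : 'I_n -> R -> R[i]) : (forall i, S (e i)) ->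
  (forall k : 'I_n -> R[i], (forall x, D x -> \sum_(i < n) k i * e i x = 0) ->
    forall i, k i = 0) -> (n <= m)%N.
Proof.
by move=> Se /(free_independent Se) /eqP <-; exact: rank_leq_col.
Qed.

(** A family in S' of largest size whose images under L are linearly independent
is a basis: the image of any other element of S' lies in their span, and L is
faithful on the difference, which lies in S. *)
Lemma faithful_has_dim (S' : set (R -> R[i])) : S' `<=` S ->
  exists2 n, (n <= m)%N & has_dim D S' n.
Proof.
move=> S'S.
pose p n := `[< exists2 e : 'I_n -> R -> R[i],
  forall i, S' (e i) & row_free (coord e) >].
have p0 : exists n, p n.
  exists 0%N; apply/asboolP; exists (fun=> cst 0); first by case.
  by rewrite /row_free flatmx0 mxrank0.
have pm n : p n -> (n <= m)%N.
  by move=> /asboolP[e _ /eqP <-]; exact: rank_leq_col.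
have [n /asboolP[e S'e fr] nmax] := ex_maxnP p0 pm.
have Se i : S (e i) by exact: S'S.
exists n; first by apply: pm; apply/asboolP; exists e.
exists e; split=> //; first exact/free_independent.
move=> y S'y.
have sub : (L y <= coord e)%MS.
  apply: contraT => nsub; suff /nmax : p n.+1 by rewrite ltnn.
  pose e' (i : 'I_(1 + n)) := match fintype.split i with inl _ => y | inr j => e j end.
  have S'e' i : S' (e' i) by rewrite /e'; case: (fintype.split i).
  have rf : row_free (col_mx (L y) (coord e)).
    have lt : (\rank (coord e) < \rank (col_mx (L y) (coord e)))%N.
      by apply: rank_ltmx; rewrite ltmxE col_mx_sub (negPf nsub) -addsmxE addsmxSr.
    rewrite /row_free eqn_leq rank_leq_row /=; apply: leq_trans lt.
    by rewrite (eqP fr).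
  apply/asboolP; exists e' => //; move: rf; congr row_free.
  apply/matrixP => i c; rewrite mxE [RHS]mxE /e'.
  by case: (fintype.split i) => j; rewrite ?mxE ?ord1.
have /submxP[k kE] := sub; exists (fun i => k 0 i) => x Dx.
have [Sz Lz] := sumS (- k) Se (S'S y S'y).
move: Lz; rewrite kE mulNmx addNr => /(faithful_eq0 SL Sz) /(_ x Dx).
move/eqP; rewrite addrC addr_eq0 => /eqP ->.
by rewrite -sumrN; apply: eq_bigr => i _; rewrite mxE mulNr opprK.
Qed.

End faithful_theory.

(** * The two sides of the interface *)

Lemma in_L2_sub (R : realType) (s t s' t' : R) (f : R -> R[i]) :
  s <= s' -> t' <= t -> in_L2 `]s, t[ f -> in_L2 `]s', t'[ f.
Proof.
move=> ss tt [g [m1 m2 gi fg]].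
have sub : `]s', t'[ `<=` (`]s, t[ : set R).
  by move=> x /=; rewrite !in_itv/= => /andP[sx xt]; apply/andP; split; lra.
have mst : measurable `]s, t[%classic by exact: (measurable_itv `]s, t[).
have mst' : measurable `]s', t'[%classic by exact: (measurable_itv `]s', t'[).
exists g; split.
- exact: measurable_funS m1.
- exact: measurable_funS m2.
- apply: le_lt_trans gi; apply: ge0_subset_integral => //.
  + by apply/measurable_EFinP/measurable_funD; exact: measurable_funX.
  + by move=> x _; rewrite lee_fin addr_ge0 ?sqr_ge0.
- move: fg; apply: filterS; first exact: (ae_filter_ringOfSetsType lebesgue_measure).
  by move=> x fg /sub.
Qed.

Section problem.
Context (R : realType) (P : sl_problem R) (lam : R[i]).

Let a0 : - sl_a P < 0 :> R. Proof. by rewrite oppr_lt0 sl_a_gt0. Qed.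
Let b0 : 0 < sl_b P. Proof. exact: sl_b_gt0. Qed.

Definition left_space (y : R -> R[i]) : Prop :=
  sl_weak (sl_q P) lam (- sl_a P) 0 y /\ bc_left P y.

Definition right_space (y : R -> R[i]) : Prop :=
  sl_weak (sl_q P) lam 0 (sl_b P) y /\ bc_right P y.

(** The boundary condition says that (y(-a), y'(-a)) is a multiple of
(sin alpha, cos alpha); this is the multiple. *)
Definition left_datum (y : R -> R[i]) : R[i] :=
  climit (- sl_a P)^'+ y * (sin (sl_alpha P))%:C%C
  + climit (- sl_a P)^'+ (cderiv y) * (cos (sl_alpha P))%:C%C.

Definition right_datum (y : R -> R[i]) : R[i] :=
  climit (sl_b P)^'- y * (sin (sl_beta P))%:C%C
  + climit (sl_b P)^'- (cderiv y) * (cos (sl_beta P))%:C%C.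

Let bc_datum (u u' : R[i]) (x : R) :
  u * (cos x)%:C%C = u' * (sin x)%:C%C ->
  u * (sin x)%:C%C + u' * (cos x)%:C%C = 0 -> u = 0 /\ u' = 0.
Proof.
move=> bc d0.
have cs : (cos x)%:C%C ^+ 2 + (sin x)%:C%C ^+ 2 = 1 :> R[i].
  by rewrite -!rmorphXn -rmorphD/= cos2Dsin2.
split.
  rewrite -[u]mulr1 -cs.
  have -> : u * ((cos x)%:C%C ^+ 2 + (sin x)%:C%C ^+ 2) =
    u * (cos x)%:C%C * (cos x)%:C%C + u * (sin x)%:C%C * (sin x)%:C%C by ring.
  by rewrite bc mulrAC -mulrDl addrC d0 mul0r.
rewrite -[u']mulr1 -cs.
have -> : u' * ((cos x)%:C%C ^+ 2 + (sin x)%:C%C ^+ 2) =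
  u' * (sin x)%:C%C * (sin x)%:C%C + u' * (cos x)%:C%C * (cos x)%:C%C by ring.
by rewrite -bc mulrAC -mulrDl d0 mul0r.
Qed.

Let q_left : in_L2 `]- sl_a P, 0[ (sl_q P).
Proof. by apply: in_L2_sub (sl_q_L2 P) => //; exact: ltW. Qed.

Let q_right : in_L2 `]0, sl_b P[ (sl_q P).
Proof. by apply: in_L2_sub (sl_q_L2 P) => //; exact: ltW. Qed.

Let trace0 (s t : R) (F : set_system R) (y : R -> R[i]) :
  borders s t F -> (forall x, s < x < t -> y x = 0) ->
  climit F y = 0 /\ climit F (cderiv y) = 0.
Proof.
move=> BF y0; have FF := proj1 BF.
have E : cderiv (cst (0 : R[i])) = cst 0 :> (R -> R[i]).
  by apply/funext => x; have [_ ->] := cderiv_cst (0 : R[i]) x.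
have tr z : lim_exists F (cst z : R -> R[i]) /\ climit F (cst z) = z.
  by apply: ccvg_lim; split; exact: cvg_cst.
have [] := trace_eq (z := y) BF (y := cst 0).
- by move=> x /y0 ->.
- by split; rewrite ?E; exact: (proj1 (tr 0)).
by move=> _ -> ->; rewrite E; have [_ ->] := tr 0.
Qed.

(** Under the boundary condition the datum determines the Cauchy data at -a, and
these determine the solution. *)
Lemma left_space_eq0 y : left_space y ->
  left_datum y = 0 <-> (forall x, - sl_a P < x < 0 -> y x = 0).
Proof.
move=> [wy bcy]; split=> [d0|y0].
  by have [u0 u'0] := bc_datum bcy d0; exact: (weak_zero_left q_left wy).
have [u0 u'0] := trace0 (borders_left a0) y0.
by rewrite /left_datum u0 u'0 !mul0r addr0.
Qed.

Lemma right_space_eq0 y : right_space y ->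
  right_datum y = 0 <-> (forall x, 0 < x < sl_b P -> y x = 0).
Proof.
move=> [wy bcy]; split=> [d0|y0].
  by have [u0 u'0] := bc_datum bcy d0; exact: (weak_zero_right q_right wy).
have [u0 u'0] := trace0 (borders_right b0) y0.
by rewrite /right_datum u0 u'0 !mul0r addr0.
Qed.

Lemma left_space_lincomb k y z : left_space y -> left_space z ->
  [/\ left_space (lincomb k y z),
      left_datum (lincomb k y z) = k * left_datum y + left_datum z,
      climit 0^'- (lincomb k y z) = k * climit 0^'- y + climit 0^'- z &
      climit 0^'- (cderiv (lincomb k y z))
      = k * climit 0^'- (cderiv y) + climit 0^'- (cderiv z)].
Proof.
move=> [wy by_] [wz bz].
have [dy _ tys tyt _] := wy; have [dz _ tzs tzt _] := wz.
have [_ e1 e2] := trace_lincomb k (borders_left a0) dy dz tys tzs.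
have [_ e3 e4] := trace_lincomb k (borders_right a0) dy dz tyt tzt.
split; [|by rewrite /left_datum e1 e2 !mulrDl mulrDr !mulrA addrACA|exact: e3|exact: e4].
split; first exact: sl_weak_lincomb.
by rewrite /bc_left e1 e2 !mulrDl -!mulrA by_ bz.
Qed.

Lemma right_space_lincomb k y z : right_space y -> right_space z ->
  [/\ right_space (lincomb k y z),
      right_datum (lincomb k y z) = k * right_datum y + right_datum z,
      climit 0^'+ (lincomb k y z) = k * climit 0^'+ y + climit 0^'+ z &
      climit 0^'+ (cderiv (lincomb k y z))
      = k * climit 0^'+ (cderiv y) + climit 0^'+ (cderiv z)].
Proof.
move=> [wy by_] [wz bz].
have [dy _ tys tyt _] := wy; have [dz _ tzs tzt _] := wz.
have [_ e1 e2] := trace_lincomb k (borders_right b0) dy dz tyt tzt.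
have [_ e3 e4] := trace_lincomb k (borders_left b0) dy dz tys tzs.
split; [|by rewrite /right_datum e1 e2 !mulrDl mulrDr !mulrA addrACA|exact: e3|exact: e4].
split; first exact: sl_weak_lincomb.
by rewrite /bc_right e1 e2 !mulrDl -!mulrA by_ bz.
Qed.

Definition sides_space : set (R -> R[i]) := [set y | left_space y /\ right_space y].

Lemma problem_sides : problem_solution P lam `<=` sides_space.
Proof.
by move=> y [[/sl_solution_weak ? /sl_solution_weak ?] ? ? _ _]; split; split.
Qed.

Let domP (y : R -> R[i]) : (forall x, problem_dom P x -> y x = 0) <->
  (forall x, - sl_a P < x < 0 -> y x = 0) /\ (forall x, 0 < x < sl_b P -> y x = 0).
Proof.
split=> [H|[H1 H2] x [] /=]; rewrite ?in_itv/=; [|exact: H1|exact: H2].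
by split=> x xst; apply: H; [left|right]; rewrite /= in_itv.
Qed.

Lemma sides_faithful : faithful (problem_dom P) sides_space
  (fun y => row_mx (left_datum y)%:M (right_datum y)%:M : 'rV_(1 + 1)).
Proof.
split.
- move=> k y z [ly ry] [lz rz].
  by have [] := left_space_lincomb k ly lz; have [] := right_space_lincomb k ry rz.
- move=> k y z [ly ry] [lz rz].
  have [_ -> _ _] := left_space_lincomb k ly lz.
  have [_ -> _ _] := right_space_lincomb k ry rz.
  by rewrite scale_row_mx !scale_scalar_mx add_row_mx -!raddfD.
- move=> y [ly ry]; rewrite domP -(left_space_eq0 ly) -(right_space_eq0 ry).
  rewrite -row_mx0; split=> [/eq_row_mx[/rowP/(_ 0) + /rowP/(_ 0)]|[-> ->]].
    by rewrite !mxE !eqxx !mulr1n.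
  by rewrite !raddf0.
Qed.

Lemma rV1_faithful (D : set R) (S : set (R -> R[i])) (f : (R -> R[i]) -> R[i]) :
  (forall k y z, S y -> S z -> S (lincomb k y z)) ->
  (forall k y z, S y -> S z -> f (lincomb k y z) = k * f y + f z) ->
  (forall y, S y -> f y = 0 <-> (forall x, D x -> y x = 0)) ->
  faithful D S (fun y => (f y)%:M : 'rV_1).
Proof.
move=> Sl fl f0; split=> //.
- by move=> k y z Sy Sz; rewrite fl// raddfD/= scale_scalar_mx.
- move=> y Sy; rewrite -f0//; split=> [/rowP/(_ 0)|->]; last by rewrite raddf0.
  by rewrite !mxE eqxx mulr1n.
Qed.

Lemma has_dim_le (D : set R) (S S' : set (R -> R[i])) m
    (L : (R -> R[i]) -> 'rV[R[i]]_m) n :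
  faithful D S L -> has_dim D S' n -> S' `<=` S -> (n <= m)%N.
Proof.
move=> SL [e [Se ind _]] S'S.
by apply: (faithful_independent_le SL _ ind) => i; exact: S'S.
Qed.

(** A solution with vanishing left datum vanishes on the left, so both its left
limits at 0 are 0.  The condition with nu then gives y(0+) = 0, and the
condition with mu gives y'(0+) = 0: the solution vanishes on the right too. *)
Lemma no_pole_simple n : ~ is_pole (sl_mu P) lam -> ~ is_pole (sl_nu P) lam ->
  sl_geometric_multiplicity P lam n -> (n <= 1)%N.
Proof.
move=> nmu nnu dim.
pose S : set (R -> R[i]) := [set y | [/\ sides_space y,
  climit 0^'+ y * sl_mu P lam = sl_jump (cderiv y) &
  climit 0^'- (cderiv y) * sl_nu P lam = sl_jump y]].
suff SL : faithful (problem_dom P) S (fun y => (left_datum y)%:M : 'rV_1).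
  apply: (has_dim_le SL dim) => y soly; split; first exact: problem_sides.
    by have [_ _ _ [_ +] _] := soly; exact.
  by have [_ _ _ _ [_ +]] := soly; exact.
apply: rV1_faithful.
- move=> k y z [[ly ry] my ny] [[lz rz] mz nz].
  have [ll _ l0 l1] := left_space_lincomb k ly lz.
  have [rr _ r0 r1] := right_space_lincomb k ry rz.
  split; first by split.
    rewrite /sl_jump r0 r1 l1 mulrDl -mulrA my mz /sl_jump.
    by rewrite mulrBr opprD addrACA.
  rewrite /sl_jump r0 l1 l0 mulrDl -mulrA ny nz /sl_jump.
  by rewrite mulrBr opprD addrACA.
- move=> k y z [[ly ry] my ny] [[lz rz] mz nz].
  by have [_ -> _ _] := left_space_lincomb k ly lz.
- move=> y [[ly ry] my ny]; rewrite domP (left_space_eq0 ly).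
  split=> [y0|[]//]; split=> //.
  have [u0 u'0] := trace0 (borders_right a0) y0.
  have v0 : climit 0^'+ y = 0.
    by move: ny; rewrite /sl_jump u0 u'0 mul0r subr0.
  have v'0 : climit 0^'+ (cderiv y) = 0.
    by move: my; rewrite /sl_jump v0 u'0 mul0r subr0.
  exact: (weak_zero_left q_right (proj1 ry)).
Qed.

Let not_nonzero (D : set R) (y : R -> R[i]) :
  ~ nonzero_on D y -> forall x, D x -> y x = 0.
Proof.
by move=> ny x Dx; apply/eqP; apply: contrapT => /negP yx; apply: ny; exists x.
Qed.

(** Otherwise all solutions live on the right, where the right datum alone
bounds the dimension by 1. *)
Lemma double_nonzero_left : sl_geometric_multiplicity P lam 2 ->
  exists2 y, problem_solution P lam y & nonzero_on `]- sl_a P, 0[ y.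
Proof.
move=> dim; apply: contrapT => none.
pose S : set (R -> R[i]) := [set y | sides_space y /\
  forall x, - sl_a P < x < 0 -> y x = 0].
suff SL : faithful (problem_dom P) S (fun y => (right_datum y)%:M : 'rV_1).
  suff : (2 <= 1)%N by [].
  apply: (has_dim_le SL dim) => y soly; split; first exact: problem_sides.
  move=> x xst; apply: (@not_nonzero `]- sl_a P, 0[); last by rewrite /= in_itv.
  by move=> ny; apply: none; exists y.
apply: rV1_faithful.
- move=> k y z [[ly ry] y0] [[lz rz] z0].
  have [ll _ _ _] := left_space_lincomb k ly lz.
  have [rr _ _ _] := right_space_lincomb k ry rz.
  by split=> // x xst; rewrite /lincomb y0// z0// mulr0 addr0.
- move=> k y z [[ly ry] y0] [[lz rz] z0].
  by have [_ -> _ _] := right_space_lincomb k ry rz.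
- move=> y [[ly ry] y0]; rewrite domP (right_space_eq0 ry).
  by split=> [y0'|[]//]; split.
Qed.

Lemma double_nonzero_right : sl_geometric_multiplicity P lam 2 ->
  exists2 y, problem_solution P lam y & nonzero_on `]0, sl_b P[ y.
Proof.
move=> dim; apply: contrapT => none.
pose S : set (R -> R[i]) := [set y | sides_space y /\
  forall x, 0 < x < sl_b P -> y x = 0].
suff SL : faithful (problem_dom P) S (fun y => (left_datum y)%:M : 'rV_1).
  suff : (2 <= 1)%N by [].
  apply: (has_dim_le SL dim) => y soly; split; first exact: problem_sides.
  move=> x xst; apply: (@not_nonzero `]0, sl_b P[); last by rewrite /= in_itv.
  by move=> ny; apply: none; exists y.
apply: rV1_faithful.
- move=> k y z [[ly ry] y0] [[lz rz] z0].
  have [ll _ _ _] := left_space_lincomb k ly lz.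
  have [rr _ _ _] := right_space_lincomb k ry rz.
  by split=> // x xst; rewrite /lincomb y0// z0// mulr0 addr0.
- move=> k y z [[ly ry] y0] [[lz rz] z0].
  by have [_ -> _ _] := left_space_lincomb k ly lz.
- move=> y [[ly ry] y0]; rewrite domP (left_space_eq0 ly).
  by split=> [y0'|[]//]; split.
Qed.

Definition glue (f g : R -> R[i]) : R -> R[i] :=
  fun x => if x < 0 then f x else g x.

Let glueL f g x : - sl_a P < x < 0 -> f x = glue f g x.
Proof. by move=> /andP[_ x0]; rewrite /glue x0. Qed.

Let glueR f g x : 0 < x < sl_b P -> g x = glue f g x.
Proof. by move=> /andP[x0 _]; rewrite /glue ltNge ltW. Qed.

(** The two transmission conditions as a relation between the limits u, u' of y
and y' at 0- and the limits v, v' at 0+. *)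
Definition interface (u u' v v' : R[i]) : Prop :=
  ((is_pole (sl_mu P) lam -> v = 0) /\
   (~ is_pole (sl_mu P) lam -> v * sl_mu P lam = v' - u')) /\
  ((is_pole (sl_nu P) lam -> u' = 0) /\
   (~ is_pole (sl_nu P) lam -> u' * sl_nu P lam = v - u)).

Lemma glue_solution f g :
  sl_solution (sl_q P) lam (- sl_a P) 0 f -> bc_left P f ->
  sl_solution (sl_q P) lam 0 (sl_b P) g -> bc_right P g ->
  interface (climit 0^'- f) (climit 0^'- (cderiv f))
            (climit 0^'+ g) (climit 0^'+ (cderiv g)) ->
  problem_solution P lam (glue f g).
Proof.
move=> sf bf sg bg itf.
have [[_ _ _ tfs tft] _] := sf; have [[_ _ _ tgs tgt] _] := sg.
have [_ e1 e2] := trace_eq (borders_left a0) (@glueL f g) tfs.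
have [_ e3 e4] := trace_eq (borders_right a0) (@glueL f g) tft.
have [_ e5 e6] := trace_eq (borders_left b0) (@glueR f g) tgs.
have [_ e7 e8] := trace_eq (borders_right b0) (@glueR f g) tgt.
split.
- split; first exact: sl_solution_eq (@glueL f g) sf.
  exact: sl_solution_eq (@glueR f g) sg.
- by rewrite /bc_left e1 e2.
- by rewrite /bc_right e7 e8.
- by rewrite /transmission_mu /sl_jump e4 e5 e6; exact: (proj1 itf).
- by rewrite /transmission_nu /sl_jump e3 e4 e5; exact: (proj2 itf).
Qed.

Let zero_side (s t : R) : s < t ->
  [/\ sl_solution (sl_q P) lam s t (cst 0),
      climit s^'+ (cst 0) = 0 :> R[i] /\ climit s^'+ (cderiv (cst 0)) = 0 :> R[i] &
      climit t^'- (cst 0) = 0 :> R[i] /\ climit t^'- (cderiv (cst 0)) = 0 :> R[i]].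
Proof.
move=> st; split.
- by apply: sl_solution_cst => // x _; rewrite !mulr0.
- by apply: (trace0 (borders_left st)).
- by apply: (trace0 (borders_right st)).
Qed.

Let left_proportional f y : left_space f -> left_space y ->
  nonzero_on `]- sl_a P, 0[ f ->
  exists k, forall x, - sl_a P < x < 0 -> y x = k * f x.
Proof.
move=> lf ly [x0 x0P fx0].
have d0 : left_datum f != 0.
  apply: contra fx0 => /eqP /(left_space_eq0 lf) f0; apply/eqP/f0.
  by move: x0P; rewrite /= in_itv.
exists (left_datum y / left_datum f) => x xst.
have [lz dz _ _] := left_space_lincomb (- (left_datum y / left_datum f)) lf ly.
have := proj1 (left_space_eq0 lz) _ x xst.
rewrite dz mulNr divfK// addNr => /(_ erefl).
by rewrite /lincomb mulNr => /eqP; rewrite addrC subr_eq0 => /eqP.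
Qed.

Let right_proportional f y : right_space f -> right_space y ->
  nonzero_on `]0, sl_b P[ f ->
  exists k, forall x, 0 < x < sl_b P -> y x = k * f x.
Proof.
move=> lf ly [x0 x0P fx0].
have d0 : right_datum f != 0.
  apply: contra fx0 => /eqP /(right_space_eq0 lf) f0; apply/eqP/f0.
  by move: x0P; rewrite /= in_itv.
exists (right_datum y / right_datum f) => x xst.
have [lz dz _ _] := right_space_lincomb (- (right_datum y / right_datum f)) lf ly.
have := proj1 (right_space_eq0 lz) _ x xst.
rewrite dz mulNr divfK// addNr => /(_ erefl).
by rewrite /lincomb mulNr => /eqP; rewrite addrC subr_eq0 => /eqP.
Qed.

(** The hypotheses on [interface] say that f extended by 0 to the right and g
extended by 0 to the left both satisfy the transmission conditions; these two
functions span the solutions. *)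
Lemma glue_double f g :
  sl_solution (sl_q P) lam (- sl_a P) 0 f -> bc_left P f ->
  nonzero_on `]- sl_a P, 0[ f ->
  sl_solution (sl_q P) lam 0 (sl_b P) g -> bc_right P g ->
  nonzero_on `]0, sl_b P[ g ->
  interface (climit 0^'- f) (climit 0^'- (cderiv f)) 0 0 ->
  interface 0 0 (climit 0^'+ g) (climit 0^'+ (cderiv g)) ->
  sl_eigenvalue_of_mult P lam 2.
Proof.
move=> sf bf nf sg bg ng itf itg.
have [s0l [z1 z1'] [z2 z2']] := zero_side a0.
have [s0r [z3 z3'] [z4 z4']] := zero_side b0.
have b0r : bc_right P (cst 0) by rewrite /bc_right z4 z4' !mul0r.
have b0l : bc_left P (cst 0) by rewrite /bc_left z1 z1' !mul0r.
have itf' : interface (climit 0^'- f) (climit 0^'- (cderiv f))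
    (climit 0^'+ (cst 0)) (climit 0^'+ (cderiv (cst 0))) by rewrite z3 z3'.
have itg' : interface (climit 0^'- (cst 0)) (climit 0^'- (cderiv (cst 0)))
    (climit 0^'+ g) (climit 0^'+ (cderiv g)) by rewrite z2 z2'.
have sol0 := glue_solution sf bf s0r b0r itf'.
have sol1 := glue_solution s0l b0l sg bg itg'.
have [x0 x0P fx0] := nf; have [x1 x1P gx1] := ng.
have x0I : - sl_a P < x0 < 0 by move: x0P; rewrite /= in_itv.
have x1I : 0 < x1 < sl_b P by move: x1P; rewrite /= in_itv.
split.
  exists (glue f (cst 0)) => //; exists x0; first by left.
  by rewrite -(glueL _ _ x0I).
pose e (i : 'I_2) := if i == ord0 then glue f (cst 0) else glue (cst 0) g.
have eE (k : 'I_2 -> R[i]) x : \sum_(i < 2) k i * e i x =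
    k ord0 * glue f (cst 0) x + k (lift ord0 ord0) * glue (cst 0) g x.
  by rewrite !big_ord_recl big_ord0 addr0.
exists e; split.
- by move=> i; rewrite /e; case: ifP.
- move=> k k0.
  have k00 : k ord0 = 0.
    have := k0 x0 (or_introl x0P); rewrite eE -!(glueL _ _ x0I) mulr0 addr0.
    by move/eqP; rewrite mulf_eq0 (negPf fx0) orbF => /eqP.
  have k10 : k (lift ord0 ord0) = 0.
    have := k0 x1 (or_intror x1P); rewrite eE -!(glueR _ _ x1I) mulr0 add0r.
    by move/eqP; rewrite mulf_eq0 (negPf gx1) orbF => /eqP.
  by move=> i; case: (unliftP ord0 i) => [j ->|->//]; rewrite (ord1 j).
- move=> y /problem_sides[ly ry].
  have lf : left_space f by split=> //; exact: sl_solution_weak.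
  have rg : right_space g by split=> //; exact: sl_solution_weak.
  have [k0 k0E] := left_proportional lf ly nf.
  have [k1 k1E] := right_proportional rg ry ng.
  exists (fun i => if i == ord0 then k0 else k1) => x; rewrite eE /=.
  case=> /=; rewrite in_itv/= => xst.
    by rewrite -!(glueL _ _ xst) mulr0 addr0 k0E.
  by rewrite -!(glueR _ _ xst) mulr0 add0r k1E.
Qed.

(** A pole forces y(0+) = 0 or y'(0-) = 0, and with this value inserted each
transmission condition involves the limits from one side only.  Hence the
restrictions of a solution to the two sides solve the one-sided problems, and
conversely solutions of these can be extended by 0. *)
Lemma double_eigenvalueP : sl_eigenvalue_of_mult P lam 2 <->
  [\/ [/\ is_pole (sl_mu P) lam, ~ is_pole (sl_nu P) lam,
          left_eigenvalue P lam (fun u u' => sl_nu P lam * u' + u = 0) &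
          right_eigenvalue P lam (fun u u' => u = 0)],
      [/\ is_pole (sl_nu P) lam, ~ is_pole (sl_mu P) lam,
          left_eigenvalue P lam (fun u u' => u' = 0) &
          right_eigenvalue P lam (fun u u' => u * sl_mu P lam = u')] |
      [/\ is_pole (sl_mu P) lam, is_pole (sl_nu P) lam,
          left_eigenvalue P lam (fun u u' => u' = 0) &
          right_eigenvalue P lam (fun u u' => u = 0)]].
Proof.
split=> [[_ dim]|].
  have [f [[sf _] bf _ mf nf] f0] := double_nonzero_left dim.
  have [g [[_ sg] _ bg mg ng] g0] := double_nonzero_right dim.
  case: (pselect (is_pole (sl_mu P) lam)) => pm;
    case: (pselect (is_pole (sl_nu P) lam)) => pn.
  - apply: Or33; split=> //; [exists f => //|exists g => //]; split=> //.
      exact: (proj1 nf).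
    exact: (proj1 mg).
  - apply: Or31; split=> //; [exists f => //|exists g => //]; split=> //.
      have := proj2 nf pn; rewrite /sl_jump (proj1 mf pm) sub0r mulrC => ->.
      by rewrite addNr.
    exact: (proj1 mg).
  - apply: Or32; split=> //; [exists f => //|exists g => //]; split=> //.
      exact: (proj1 nf).
    by have := proj2 mg pm; rewrite /sl_jump (proj1 ng pn) subr0.
  - by have := no_pole_simple pm pn dim.
move=> [] [p1 p2 [f [sf bf cf] nf] [g [sg bg cg] ng]];
  apply: (glue_double sf bf nf sg bg ng); split; split=> //.
- by move=> _; rewrite sub0r; apply/eqP; rewrite mulrC -addr_eq0 cf.
- by move=> _; rewrite cg mul0r subr0.
- by move=> _; rewrite cf mul0r subr0.
- by move=> _; rewrite cg subr0.
Qed.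

End problem.

(** * A problem with a double eigenvalue *)

Lemma is_pole_inv (K : numFieldType) (f : K -> K) :
  (forall z, z != 0 -> `|f z| = `|z|^-1) -> is_pole f 0.
Proof.
move=> fE A [M [Mr MA]].
have M0 : 0 < `|M| + 1 by rewrite ltr_pwDr.
have r0 : 0 < (`|M| + 1)^-1 by rewrite invr_gt0.
apply/nbhs_ballP; exists (`|M| + 1)^-1 => //= z; rewrite /ball/= sub0r normrN => zr z0.
apply: MA; rewrite fE//; apply: le_lt_trans (real_ler_norm Mr) _.
apply: (@lt_trans _ _ (`|M| + 1)); first by rewrite ltrDl.
by rewrite -[ltLHS]invrK ltf_pV2// posrE normr_gt0.
Qed.

Lemma not_pole_cst (K : numFieldType) (c lam : K) : ~ is_pole (cst c) lam.
Proof.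
move=> cy; have big : \forall x \near (+oo : set_system K), `|c| < x.
  by exists `|c|; split; first exact: normr_real.
have [z cz] := @filter_ex _ (dnbhs lam) _ _ (cy _ big).
by move: (cz : `|c| < `|c|); rewrite ltxx.
Qed.

Section example.
Context (R : realType).

Let gt01 : (0 : R) < 1. Proof. exact: ltr01. Qed.
Let q_L2 : in_L2 `]- 1, 1[ (cst 0 : R -> R[i]). Proof. exact: in_L2_cst. Qed.
Let alpha_range : 0 <= (pi / 2 : R) < pi.
Proof. by have := pi_gt0 R => ?; apply/andP; split; lra. Qed.
Let beta_range : 0 < (pi / 2 : R) <= pi.
Proof. by have := pi_gt0 R => ?; apply/andP; split; lra. Qed.
Let c_incr (i j : 'I_0) : (i < j)%N -> (0 : R) < 0. Proof. by case: i. Qed.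
Let d_incr (i j : 'I_1) : (i < j)%N -> (0 : R) < 0. Proof. by rewrite !ord1. Qed.

Definition free_problem : sl_problem R :=
  @SLProblem R 1 1 (cst 0) (pi / 2) (pi / 2) 0 1 0 0 0 0
    (fun=> 0) (fun=> 1) (fun=> 0) (fun=> 1) gt01 gt01 q_L2 alpha_range beta_range
    (lexx 0) (lexx 0) c_incr d_incr (fun=> gt01) (fun=> gt01).

Lemma mu_free_problem : sl_mu free_problem = cst 0.
Proof.
by apply/funext => z; rewrite /sl_mu /= big_ord0 mulr0 !subr0 oppr0.
Qed.

Lemma free_problem_double : sl_eigenvalue_of_mult free_problem 0 2.
Proof.
have E (c : R[i]) : cderiv (cst c) = cst 0 :> (R -> R[i]).
  by apply/funext => x; have [_ ->] := cderiv_cst c x.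
have lc (F : set_system R) (FF : ProperFilter F) (c : R[i]) : climit F (cst c) = c.
  by have [] := @ccvg_lim R F FF (cst c) c _ => //; split; exact: cvg_cst.
have one_sol s t : s < t -> sl_solution (sl_q free_problem) 0 s t (cst 1).
  by move=> st; apply: sl_solution_cst => // x _; rewrite /= !mul0r.
apply/double_eigenvalueP/Or32; split.
- apply: is_pole_inv => z z0.
  rewrite /sl_nu /= big_ord1 mulr0 !addr0 add0r normrN normf_div.
  by rewrite subr0 expr1n normr1 mul1r.
- by rewrite mu_free_problem; exact: not_pole_cst.
- exists (cst 1); last first.
    by exists (- 2^-1); rewrite /= ?in_itv/= ?oner_neq0//; lra.
  split; first by apply: one_sol; rewrite /= oppr_lt0.
    by rewrite /bc_left E !lc /= cos_pihalf mulr0 mul0r.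
  by rewrite E lc.
- exists (cst 1); last first.
    by exists (2^-1); rewrite /= ?in_itv/= ?oner_neq0//; lra.
  split; first by apply: one_sol.
    by rewrite /bc_right E !lc /= cos_pihalf mulr0 mul0r.
  by rewrite E !lc mu_free_problem mulr0.
Qed.

End example.

Theorem theorem2p2 (R : realType) :
  [/\ (* the maximum geometric multiplicity is 2: bound ... *)
      forall (P : sl_problem R) (lam : R[i]), sl_eigenvalue P lam ->
        exists2 n : nat, (n <= 2)%N & sl_geometric_multiplicity P lam n,
      (* ... which is attained in this class of problems *)
      exists (P : sl_problem R) (lam : R[i]), sl_eigenvalue_of_mult P lam 2,
      forall (P : sl_problem R) (lam : R[i]), sl_eigenvalue_of_mult P lam 2 ->
        is_pole (sl_mu P) lam \/ is_pole (sl_nu P) lam &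
      forall (P : sl_problem R) (lam : R[i]),
        sl_eigenvalue_of_mult P lam 2 <->
        [\/ [/\ is_pole (sl_mu P) lam, ~ is_pole (sl_nu P) lam,
                left_eigenvalue P lam (fun u u' => sl_nu P lam * u' + u = 0) &
                right_eigenvalue P lam (fun u u' => u = 0)],
            [/\ is_pole (sl_nu P) lam, ~ is_pole (sl_mu P) lam,
                left_eigenvalue P lam (fun u u' => u' = 0) &
                right_eigenvalue P lam (fun u u' => u * sl_mu P lam = u')] |
            [/\ is_pole (sl_mu P) lam, is_pole (sl_nu P) lam,
                left_eigenvalue P lam (fun u u' => u' = 0) &
                right_eigenvalue P lam (fun u u' => u = 0)]]].
Proof.
split=> [P lam _|||P lam]; last exact: double_eigenvalueP.
- exact: (faithful_has_dim (sides_faithful P lam) (@problem_sides R P lam)).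
- by exists (free_problem R), 0; exact: free_problem_double.
- move=> P lam [_ dim]; apply: contrapT => /not_orP[pm pn].
  by have := no_pole_simple pm pn dim.
Qed.
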